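(* Suppose $b:[0,\infty)\to\mathbb R$ is continuous and satisfies $$\lim_{t\uparrow\infty}\bigl(b(t)+\alpha t\bigr)>-\infty\qquad\text{for all }\alpha>0 .$$ If the integral equation $$\int_0^\infty f(t|x)\,g(x)\,dx=f(t)$$ has a solution $g\in\mathcal G$, then it is unique and its Laplace transform $\tilde g(\alpha)=\int_0^\infty e^{-\alpha x}g(x)\,dx$ is $$\tilde g(\alpha)=\int_0^\infty e^{-\alpha b(t)-t\alpha^2/2}f(t)\,dt,\qquad \alpha>0 .$$
   Context: $W_t$ is a standard Brownian motion started at $0$. The boundary $b$ satisfies $b(0)=0$ and is (standing assumption) continuously differentiable, which ensures that for $x>0$ the first passage time $\tau_x=\inf\{t>0: W_t+x\le b(t)\}$ has a continuous density, denoted $f(t|x)$ (i.e. the density of $\tau_X$ conditional on $X=x$). $f$ is a given probability density on $[0,\infty)$ (the target density). $\mathcal G$ is the class of functions $g$ on $(0,\infty)$ such that $\int_0^\infty|g(x)|\,dx<\infty$ or $|g|<K$ for some constant $K$. Functions are identified when equal almost everywhere. *)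

(* Defs.v *)
From HB Require Import structures.
From mathcomp Require Import all_boot all_order all_algebra.
From mathcomp Require Import all_classical all_reals all_analysis.

Set Implicit Arguments.
Unset Strict Implicit.
Unset Printing Implicit Defensive.

Import Order.TTheory GRing.Theory Num.Theory.
Import numFieldNormedType.Exports.

Local Open Scope classical_set_scope.
Local Open Scope ring_scope.

(* Processes and functions on the half-line are indexed by the whole of R; only
   their values at times t >= 0 (resp. points x > 0) are ever constrained. *)

Section brownian_motion.
Context (d : measure_display) (T : measurableType d) (R : realType)
  (P : probability T R).

(* The sets [A i] may be taken to be [setT], so the product rule over the whole
   family contains the product rule over each of its subfamilies. *)
Definition mutually_independent (n : nat) (X : 'I_n -> T -> R) : Prop :=
  forall A : 'I_n -> set R, (forall i, measurable (A i)) ->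
    P (\bigcap_(i in [set: 'I_n]) (X i @^-1` A i)) =
    (\prod_(i < n) P (X i @^-1` A i))%E.

Definition increment (W : R -> {RV P >-> R}) (s t : R) : T -> R :=
  W t \- W s.

Record standard_brownian_motion (W : R -> {RV P >-> R}) : Prop := {
  bm_start : forall w, W 0 w = 0;
  bm_continuous : forall w, {within `[0, +oo[, continuous (fun t => W t w)};
  bm_independent_increments : forall (n : nat) (t : nat -> R),
    0 <= t 0%N -> nondecreasing_seq t ->
    mutually_independent (fun i : 'I_n => increment W (t i) (t i.+1));
  (* the second argument of normal_prob is the standard deviation *)
  bm_gaussian_increments : forall s t : R, 0 <= s -> s < t ->
    forall A : set R, measurable A ->
    P (increment W s t @^-1` A) = normal_prob 0 (Num.sqrt (t - s)) A
}.

(* Extended-real valued: the infimum of the empty set is +oo. *)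
Definition first_passage_time (W : R -> {RV P >-> R}) (b : R -> R) (x : R)
    (w : T) : \bar R :=
  ereal_inf [set t%:E | t in [set t : R | 0 < t /\ W t w + x <= b t]].

(* [p t x] stands for f(t|x). The law of the first passage time may have an atom
   at +oo, so [p ^~ x] need not have total mass 1. *)
Record first_passage_density (W : R -> {RV P >-> R}) (b : R -> R)
    (p : R -> R -> R) : Prop := {
  fpd_ge0 : forall x t : R, 0 < x -> 0 < t -> 0 <= p t x;
  fpd_continuous : forall x : R, 0 < x ->
    {within `]0, +oo[, continuous (p ^~ x)};
  fpd_law : forall x : R, 0 < x -> forall A : set R, measurable A ->
    P (first_passage_time W b x @^-1` (EFin @` A)) =
    (\int[lebesgue_measure]_(t in A `&` `]0%R, +oo[) (p t x)%:E)%E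
}.

End brownian_motion.

Section functions_on_the_half_line.
Context (R : realType).

Definition continuously_differentiable (b : R -> R) : Prop :=
  (forall t : R, 0 < t -> derivable b t 1) /\
  {within `]0, +oo[, continuous (derive1 b)}.

Definition probability_density (f : R -> R) : Prop :=
  [/\ measurable_fun (`[0, +oo[ : set R) f,
      forall t : R, 0 <= t -> 0 <= f t &
      (\int[lebesgue_measure]_(t in `[0%R, +oo[) (f t)%:E = 1)%E].

(* As functions are identified when equal almost everywhere, so is the bound. *)
Definition class_G (g : R -> R) : Prop :=
  measurable_fun (`]0, +oo[ : set R) g /\
  (lebesgue_measure.-integrable `]0, +oo[ (EFin \o g) \/
   exists K : R, {ae lebesgue_measure, forall x : R, 0 < x -> `|g x| < K}).

(* The equation is between extended reals. A Lebesgue integral whose positive and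
   negative parts are both infinite evaluates to -oo, so the equality with the
   finite value [f t] also asserts that the integral converges. *)
Definition solves_integral_equation (p : R -> R -> R) (f g : R -> R) : Prop :=
  {ae lebesgue_measure, forall t : R, 0 <= t ->
    (\int[lebesgue_measure]_(x in `]0%R, +oo[) (p t x * g x)%:E = (f t)%:E)%E}.

Definition laplace_transform (g : R -> R) (a : R) : \bar R :=
  (\int[lebesgue_measure]_(x in `]0%R, +oo[) (expR (- (a * x)) * g x)%:E)%E.

End functions_on_the_half_line.

(* Main.v *)
(* Let tau_x be the first passage time and M_t = exp(- a W_t - t a^2 / 2), a > 0. Since
   W = b - x at time tau_x and W > b - x before it, optional stopping of M at tau_x gives
     int_0^oo exp(- a b(t) - t a^2 / 2) f(t|x) dt = exp(- a x),
   the growth condition on b making the contribution of {tau_x > N} vanish as N grows.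
   Integrating this identity against g and exchanging the integrals with the help of the
   integral equation yields the Laplace transform of g, and a function of the class G is
   determined by its Laplace transform.

   Optional stopping is proved by rounding tau_x up to a grid of [0, N]: the event
   {tau_x <= s} belongs to the past of s, the rounded values are uniformly integrable
   because E[M_t^2] is bounded, and they converge to M at tau_x by continuity of the paths.
   Uniqueness of the Laplace transform uses exp(- exp(n (c - x))), a power series in
   exp(- n x) that tends to the indicator function of x > c. *)

Require Import Defs.
From HB Require Import structures.
From mathcomp Require Import all_boot all_order all_algebra.
From mathcomp Require Import all_classical all_reals all_analysis.
From mathcomp Require Import measurable_realfun ring lra.

Set Implicit Arguments.
Unset Strict Implicit.
Unset Printing Implicit Defensive.

Import Order.TTheory GRing.Theory Num.Theory.
Import numFieldNormedType.Exports.

Local Open Scope classical_set_scope.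
Local Open Scope ring_scope.

(** * Uniqueness of the Laplace transform *)

(** The obstacle to exchanging the integrals is measurability: [first_passage_density] gives
    regularity of [p t x] in [t] for fixed [x], while the integral equation integrates in [x] for
    fixed [t], and Fubini needs both variables at once. The remedy is monotonicity. A path started
    farther away hits later, so P(tau_x <= s) is monotone, hence measurable, in [x]; [p t x] is its
    derivative in [s] at [t], a limit of difference quotients measurable in [x]; continuity in [t]
    then makes [p] jointly measurable. The growth condition enters as a bound b(t) >= - C - k t on
    the whole half-line. The drift - t a^2 / 2 of the exponent beats the resulting term a k t
    exactly when k < a / 2, so treating every a > 0 requires arbitrarily small slopes k. *)

Section laplace_uniqueness.
Context {R : realType}.
Local Notation mu := (@lebesgue_measure R).

(* Expand the outer exponential in powers of [expR (- (n%:R * x))]. As [n] tends to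
   infinity, the weight tends to the indicator function of [c < x]. *)
Lemma integral_mul_exp_exp0 (K : R -> R) :
  mu.-integrable setT (EFin \o K) -> (forall x, x <= 0 -> K x = 0) ->
  (forall m : nat, (\int[mu]_x (expR (- (m%:R * x)) * K x)%:E = 0)%E) ->
  forall (n : nat) c,
    (\int[mu]_x (expR (- expR (n%:R * (c - x))) * K x)%:E = 0)%E.
Proof.
move=> iK K0 KL n c.
have mK : measurable_fun setT K by apply/measurable_EFinP; exact: measurable_int iK.
have mE (m : nat) : measurable_fun [set: R] (fun x : R => expR (- (m%:R * x)) * K x).
  apply: measurable_funM => //; apply: measurableT_comp => //.
  by apply: measurableT_comp => //; exact: measurable_funM.
have iE (m : nat) : mu.-integrable [set: R] (fun x : R => (expR (- (m%:R * x)) * K x)%:E).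
  apply: (le_integrable measurableT _ _ iK); first by apply/measurable_EFinP; exact: mE.
  move=> x _ /=; rewrite lee_fin normrM.
  have [x0|x0] := leP x 0; first by rewrite K0// normr0 mulr0.
  rewrite ler_piMl// ger0_norm ?expR_ge0// -expR0 ler_expR oppr_le0.
  by rewrite mulr_ge0// ltW.
pose f_ (M : nat) (x : R) := (series (exp_coeff (- expR (n%:R * (c - x)))) M * K x)%:E.
(* Coefficients of the expansion: the [j]-th power of the inner exponential has the natural number
   [j * n] as its rate, so each term is a multiple of a vanishing moment. *)
pose a (j : nat) : R := (-1) ^+ j * expR ((j * n)%:R * c) / j`!%:R.
have f_E M x : f_ M x =
    (\sum_(j < M) (a j)%:E * (expR (- ((j * n)%:R * x)) * K x)%:E)%E.
  rewrite /f_ /series /= big_mkord mulr_suml -sumEFin; apply: eq_bigr => j _.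
  rewrite -EFinM; congr (_%:E); rewrite /a mulrA; congr (_ * _).
  rewrite /exp_coeff /=.
  have -> : (- expR (n%:R * (c - x))) ^+ j =
      (-1) ^+ j * (expR ((j * n)%:R * c) * expR (- ((j * n)%:R * x))).
    rewrite [LHS]exprNn -expRM_natl -expRD; congr (_ * expR _).
    by rewrite natrM; ring.
  by rewrite mulrA mulrAC.
have f_0 M : (\int[mu]_x f_ M x = 0)%E.
  under eq_integral do rewrite f_E.
  rewrite integral_sum//; last by move=> j; apply: integrableZl.
  by rewrite big1// => j _; rewrite integralZl// KL mule0.
have mb : measurable_fun [set: R] (fun x : R => n%:R * (c - x)).
  by apply: measurable_funM => //; exact: measurable_funB.
have mbK : measurable_fun [set: R] (fun x : R => expR (- expR (n%:R * (c - x))) * K x).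
  apply: measurable_funM => //; apply: measurableT_comp => //.
  apply: measurableT_comp => //; exact: measurableT_comp.
have mf_ M : measurable_fun [set: R] (f_ M).
  rewrite (_ : f_ M = fun x : R =>
    \sum_(j < M) (a j)%:E * (expR (- ((j * n)%:R * x)) * K x)%:E)%E; last first.
    by apply/funext => x; rewrite f_E.
  apply: emeasurable_sum => j; apply: measurable_funeM.
  by apply/measurable_EFinP; exact: mE.
have cvgf : {ae mu, forall x : R, [set: R] x ->
    f_ ^~ x @ \oo --> (expR (- expR (n%:R * (c - x))) * K x)%:E}.
  apply: aeW => x _; apply: cvg_EFin; first by apply: nearW.
  rewrite /f_/=; apply: cvgM; last exact: cvg_cst.
  exact: is_cvg_series_exp_coeff.
(* Where [K] does not vanish, [x > 0], so the partial sums are at most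
   [expR (expR (n%:R * (c - x)))], hence at most [expR (expR (n%:R * c))]: the support of [K]
   supplies the dominating constant. *)
have ig : mu.-integrable [set: R]
    (fun x : R => (expR (expR (n%:R * c)))%:E * (`|K x|)%:E)%E.
  by apply: integrableZl => //; exact: integrable_norm.
have dom : {ae mu, forall (x : R) M, [set: R] x ->
    (`|f_ M x| <= (expR (expR (n%:R * c)))%:E * (`|K x|)%:E)%E}.
  apply: aeW => x M _ /=; rewrite -EFinM lee_fin normrM.
  have [x0|x0] := leP x 0; first by rewrite K0// normr0 !mulr0.
  rewrite ler_wpM2r//; apply: (@le_trans _ _ (series (exp_coeff (expR (n%:R * (c - x)))) M)).
    apply: (le_trans (ler_norm_sum _ _ _)).
    have <- : [normed series (exp_coeff (- expR (n%:R * (c - x))))] M =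
        series (exp_coeff (expR (n%:R * (c - x)))) M.
      by rewrite normed_series_exp_coeff normrN ger0_norm// expR_ge0.
    exact: lexx.
  apply: (@le_trans _ _ (expR (expR (n%:R * (c - x))))).
    apply: nondecreasing_cvgn_le; last exact: is_cvg_series_exp_coeff.
    by apply: nondecreasing_series => i _ _; apply: exp_coeff_ge0; exact: expR_ge0.
  rewrite !ler_expR mulrBr gerBl.
  by rewrite mulr_ge0// ltW.
have mbKE : measurable_fun [set: R]
    (fun x : R => (expR (- expR (n%:R * (c - x))) * K x)%:E).
  exact/measurable_EFinP.
have [_ _] := @dominated_convergence _ _ _ mu setT measurableT _ _ _ mf_ mbKE cvgf ig dom.
move=> cvgI; apply/esym; move: cvgI; apply: cvg_unique => //.
rewrite (_ : [sequence _]_n = cst 0%E); first exact: cvg_cst.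
by apply/funext => M /=; exact: f_0.
Qed.

Lemma integral_itvoy0 (K : R -> R) :
  mu.-integrable [set: R] (EFin \o K) -> (forall x, x <= 0 -> K x = 0) ->
  (forall m : nat, (\int[mu]_x (expR (- (m%:R * x)) * K x)%:E = 0)%E) ->
  forall c : R, (\int[mu]_(x in `]c, +oo[) (K x)%:E = 0)%E.
Proof.
move=> iK K0 KL c.
have KEE := integral_mul_exp_exp0 iK K0 KL.
have mK : measurable_fun [set: R] K by apply/measurable_EFinP; exact: measurable_int iK.
pose f_ (n : nat) (x : R) := (expR (- expR (n%:R * (c - x))) * K x)%:E.
have mf_ n : measurable_fun [set: R] (f_ n).
  apply/measurable_EFinP; apply: measurable_funM => //; apply: measurableT_comp => //.
  apply: measurableT_comp => //; apply: measurableT_comp => //.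
  by apply: measurable_funM => //; exact: measurable_funB.
have mf : measurable_fun [set: R] ((EFin \o K) \_ `]c, +oo[).
  by apply/(measurable_restrictT _ _).1 => //; apply/measurable_EFinP; exact: measurable_funTS.
have limy (y : R) : 0 < y -> (n%:R * y : R) @[n --> \oo] --> +oo.
  move=> y0; apply/cvgryPge => A.
  by apply: filterS (nbhs_infty_ger (A / y)) => n; rewrite ler_pdivrMr.
have limE (x : R) : c < x -> expR (n%:R * (c - x)) @[n --> \oo] --> (0 : R).
  move=> cx.
  rewrite (_ : (fun n : nat => _) =
      (fun y : R => expR (- y)) \o (fun n : nat => n%:R * (x - c))); last first.
    by apply/funext => n /=; congr expR; rewrite -mulrN opprB.
  by apply: (cvg_comp _ _ (limy _ _) (@cvgr_expR R)); rewrite subr_gt0.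
have limE' (x : R) : x < c -> expR (- expR (n%:R * (c - x))) @[n --> \oo] --> (0 : R).
  move=> xc; apply: (cvg_comp (fun n : nat => expR (n%:R * (c - x)))
    (fun y : R => expR (- y)) _ (@cvgr_expR R)).
  apply: (@ger_cvgy _ _ _ _ (fun k : nat => k%:R * (c - x))).
    by apply: nearW => k; rewrite (le_trans _ (expR_ge1Dx _))// lerDr.
  by apply: limy; rewrite subr_gt0.
have cvgf : {ae mu, forall x : R, [set: R] x ->
    f_ ^~ x @ \oo --> ((EFin \o K) \_ `]c, +oo[) x}.
  (* At [x = c] the weight is [expR (- 1)] for every [n], so this point is discarded as a null
     set. *)
  exists [set c]; split => //; first exact: lebesgue_measure_set1.
  move=> x /= /not_implyP[_ H]; apply: contrapT => xc; apply: H.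
  rewrite patchE mem_setE in_itv/= andbT.
  have [cx|xc'|/esym//] := ltgtP c x.
    rewrite (_ : (K x)%:E = (1 * K x)%:E); last by rewrite mul1r.
    apply: cvg_EFin; first by apply: nearW.
    apply: cvgM; last exact: cvg_cst.
    rewrite -[X in _ --> X]expR0 -[in X in _ --> X]oppr0.
    apply: continuous_cvg; first exact: continuous_expR.
    by apply: cvgN; exact: limE.
  rewrite (_ : point = (0 * K x)%:E); last by rewrite mul0r.
  apply: cvg_EFin; first by apply: nearW.
  by apply: cvgM; [exact: limE'|exact: cvg_cst].
have dom : {ae mu, forall (x : R) n, [set: R] x -> (`|f_ n x| <= (`|K x|)%:E)%E}.
  apply: aeW => x n _ /=; rewrite lee_fin normrM ler_piMl// ger0_norm ?expR_ge0//.
have [_ _] := @dominated_convergence _ _ _ mu setT measurableT _ _ _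
  mf_ mf cvgf (integrable_norm iK) dom.
move=> cvgI; rewrite integral_mkcond; apply/esym; move: cvgI; apply: cvg_unique => //.
rewrite (_ : [sequence _]_n = cst 0%E); first exact: cvg_cst.
by apply/funext => n /=; exact: KEE.
Qed.

(** The moment of order 0 and the vanishing tail integrals leave a zero integral over every []-oo,
    y]]; by Lebesgue differentiation, [K] is almost everywhere the derivative of this zero
    primitive. *)
Lemma laplace_moments_inj (K : R -> R) :
  mu.-integrable [set: R] (EFin \o K) -> (forall x, x <= 0 -> K x = 0) ->
  (forall m : nat, (\int[mu]_x (expR (- (m%:R * x)) * K x)%:E = 0)%E) ->
  {ae mu, forall x, K x = 0}.
Proof.
move=> iK K0 KL.
have mK : measurable_fun [set: R] K by apply/measurable_EFinP; exact: measurable_int iK.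
have iKy (y : R) : mu.-integrable `]-oo, y] (EFin \o K).
  exact: integrableS iK.
have F0 (y : R) : (\int[mu]_(t in `]-oo, y]) (K t) = 0)%R.
  have := integral_itvoy0 iK K0 KL y.
  have := KL 0%N; under eq_integral do rewrite mul0r oppr0 expR0 mul1r.
  have mC : measurable (~` (`]-oo, y]%classic : set R)) by apply: measurableC.
  have UC : `]-oo, y]%classic `|` ~` `]-oo, y]%classic = [set: R] by exact: setUv.
  have -> : (\int[mu]_x (K x)%:E =
      \int[mu]_(x in `]-oo, y]) (K x)%:E + \int[mu]_(x in ~` `]-oo, y]) (K x)%:E)%E.
    rewrite -integral_setU ?UC//; first exact: measurable_int iK.
    exact/disj_setPCl.
  by rewrite setCitvl => + yoo0; rewrite yoo0 adde0 /Rintegral => ->.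
have locK : locally_integrable [set: R] K.
  by have := integrable_locally measurableT iK; rewrite patch_setT.
have := FTC1Ny iKy locK.
apply: filterS; first exact: (ae_filter_ringOfSetsType mu).
move=> x [_ <-].
rewrite (_ : (fun _ => _) = cst 0) ?derive1_cst//.
by apply/funext => y; rewrite F0.
Qed.

End laplace_uniqueness.

(** * Integration *)

Section density.
Local Open Scope ereal_scope.
Context d (T : measurableType d) (R : realType).
Variables (mu nu : {measure set T -> \bar R}) (w : T -> R).
Hypothesis mw : measurable_fun setT w.
Hypothesis w0 : forall x, (0 <= w x)%R.
Hypothesis nuE : forall A, measurable A -> nu A = \int[mu]_(x in A) (w x)%:E.

Import HBNNSimple.

Lemma integral_density_nnsfun (h : {nnsfun T >-> R}) :
  \int[nu]_x (h x)%:E = \int[mu]_x ((h x)%:E * (w x)%:E).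
Proof.
have mI r : measurable_fun [set: T] (fun x => (r * \1_(h @^-1` [set r]) x)%:E).
  by apply/measurable_EFinP; exact: measurable_funM.
transitivity (\int[nu]_x (\sum_(y \in range h) (y * \1_(h @^-1` [set y]) x)%:E)).
  by apply: eq_integral => t _; rewrite /= fimfunE -fsumEFin.
rewrite ge0_integral_fsum//; last by move=> r x _; exact: nnfun_muleindic_ge0.
transitivity (\int[mu]_x (\sum_(y \in range h)
    (y * \1_(h @^-1` [set y]) x)%:E * (w x)%:E)); last first.
  apply: eq_integral => t _.
  rewrite -ge0_mule_fsuml => [|y]; last exact: nnfun_muleindic_ge0.
  by rewrite fsumEFin // -(fimfunE _ t).
rewrite ge0_integral_fsum//; last 2 first.
  - by move=> r; apply: emeasurable_funM => //; exact/measurable_EFinP.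
  - by move=> r x _; rewrite mule_ge0 ?lee_fin// -lee_fin EFinM nnfun_muleindic_ge0.
apply: eq_fsbigr => r; rewrite inE => -[t _ <-].
under eq_integral do rewrite EFinM.
under [RHS]eq_integral do rewrite EFinM -muleA.
rewrite [LHS]ge0_integralZl ?lee_fin//; last exact/measurable_EFinP.
rewrite [RHS]ge0_integralZl ?lee_fin//; last 2 first.
- by apply: emeasurable_funM; exact/measurable_EFinP.
- by move=> x _; rewrite mule_ge0 ?lee_fin.
congr (_ * _); rewrite integral_indic// setIT nuE//.
rewrite integral_mkcond; apply: eq_integral => x _.
by rewrite epatch_indic muleC.
Qed.

(** Monotone convergence from simple functions. It serves for the Gaussian law of an increment, for
    [P] restricted to an event (the density is an indicator), and for the law of the passage
    time. *)
Lemma ge0_integral_density (phi : T -> \bar R) :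
  measurable_fun setT phi -> (forall x, 0 <= phi x) ->
  \int[nu]_x phi x = \int[mu]_x (phi x * (w x)%:E).
Proof.
move=> mphi phi0.
pose h := nnsfun_approx measurableT mphi.
have hphi x : (EFin \o h n) x @[n --> \oo] --> phi x.
  by apply: cvg_nnsfun_approx.
have ndh x : {homo (fun n => (h n x)%:E) : a b / (a <= b)%N >-> a <= b}.
  by move=> a b ab; rewrite lee_fin; exact/lefP/nd_nnsfun_approx.
transitivity (limn (fun n => \int[nu]_x (h n x)%:E)).
  rewrite -monotone_convergence//.
  - by apply: eq_integral => y _; apply/esym/cvg_lim => //; exact: hphi.
  - by move=> n; exact/measurable_EFinP.
  - by move=> n y _; rewrite lee_fin.
under eq_fun do rewrite integral_density_nnsfun.
rewrite -monotone_convergence//.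
- apply: eq_integral => y _; apply/cvg_lim => //.
  by apply: cvgeZr => //; exact: hphi.
- by move=> n; apply: emeasurable_funM; exact/measurable_EFinP.
- by move=> n y _; rewrite mule_ge0 ?lee_fin.
- by move=> y _ a b ab; rewrite lee_wpmul2r ?lee_fin//; exact: ndh.
Qed.

End density.

Lemma integral_sum_indic d (T : measurableType d) (R : realType)
    (mu : {measure set T -> \bar R}) (g : nat -> T -> R) (A : nat -> set T) (n : nat) :
  (forall j, measurable_fun setT (g j)) -> (forall j w, 0 <= g j w) ->
  (forall j, measurable (A j)) ->
  (\int[mu]_w (\sum_(j < n) g j w * \1_(A j) w)%:E =
   \sum_(j < n) \int[mu]_(w in A j) (g j w)%:E)%E.
Proof.
move=> mg g0 mA.
under eq_integral do rewrite -sumEFin.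
rewrite ge0_integral_sum//; last 2 first.
- by move=> j; apply/measurable_EFinP; apply: measurable_funM => //; exact: measurable_indic.
- by move=> j w _; rewrite lee_fin mulr_ge0.
apply: eq_bigr => j _; rewrite [RHS]integral_mkcond; apply: eq_integral => w _.
by rewrite patchE indicE; case: (w \in A j); rewrite ?mulr1 ?mulr0.
Qed.


(** * The exponential martingale of Brownian motion *)

Section brownian_past.
Context (d : measure_display) (T : measurableType d) (R : realType)
  (P : probability T R) (W : R -> {RV P >-> R}).
Hypothesis hW : standard_brownian_motion W.

Lemma measurable_increment s t : measurable_fun setT (increment W s t).
Proof. by apply: measurable_funB => //; exact: measurable_funP. Qed.

Lemma increment_mgf (a s t : R) : 0 <= s -> s <= t ->
  (\int[P]_w (expR (- (a * increment W s t w)))%:E =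
   (expR ((t - s) * a ^+ 2 / 2))%:E)%E.
Proof.
move=> s0; rewrite le_eqVlt => /predU1P[<-|st].
  rewrite subrr !mul0r expR0.
  under eq_integral do rewrite /increment/= subrr mulr0 oppr0 expR0.
  by rewrite integral_cst// mul1e; exact: probability_setT.
pose sg := Num.sqrt (t - s).
have sg0 : sg != 0 by rewrite gt_eqF// sqrtr_gt0 subr_gt0.
have sg2 : sg ^+ 2 = t - s by rewrite sqr_sqrtr// subr_ge0 ltW.
pose phi := fun y : R => (expR (- (a * y)))%:E.
have mphi : measurable_fun setT phi.
  by apply/measurable_EFinP; apply: measurableT_comp => //; apply: measurableT_comp => //.
have minc : measurable_fun setT (increment W s t : T -> measurableTypeR R).
  exact: measurable_increment.
pose incM := isMeasurableFun.Build _ _ T (measurableTypeR R) _ minc.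
pose X : {mfun T >-> measurableTypeR R} :=
  HB.pack (increment W s t : T -> measurableTypeR R) incM.
transitivity (\int[distribution P X]_y phi y)%E.
  by rewrite ge0_integral_distribution// => y; rewrite lee_fin expR_ge0.
transitivity (\int[lebesgue_measure]_y (phi y * (normal_pdf 0 sg y)%:E))%E.
  apply: (@ge0_integral_density _ (measurableTypeR R) R lebesgue_measure
    (distribution P X)) => //.
  - exact: measurable_normal_pdf.
  - by move=> x; exact: normal_pdf_ge0.
  - by move=> A mA; exact: (bm_gaussian_increments hW s0 st).
  - by move=> x; rewrite lee_fin expR_ge0.
(* Completing the square: the exponential factor shifts the mean of the Gaussian density from [0] to
   [- (a * sg ^+ 2)] and leaves a constant. *)
transitivity (\int[lebesgue_measure]_y
   ((expR ((t - s) * a ^+ 2 / 2))%:E * (normal_pdf (- (a * sg ^+ 2)) sg y)%:E))%E.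
  apply: eq_integral => y _; rewrite -!EFinM; congr (_%:E).
  rewrite !normal_pdfE// mulrCA [RHS]mulrCA; congr (_ * _).
  rewrite /normal_fun -!expRD; congr expR; rewrite -sg2; field.
  by rewrite sg0.
rewrite integralZl//; last exact: integrable_normal_pdf.
by rewrite integral_normal_pdf mule1.
Qed.

Lemma independent_last_increment (u : nat -> R) (m : nat) (A : nat -> set R) (B : set R) :
  0 <= u 0%N -> nondecreasing_seq u ->
  (forall i, measurable (A i)) -> measurable B ->
  P (\bigcap_(i < m) (increment W (u i) (u i.+1) @^-1` A i) `&`
     increment W (u m) (u m.+1) @^-1` B) =
  (P (\bigcap_(i < m) (increment W (u i) (u i.+1) @^-1` A i)) *
   P (increment W (u m) (u m.+1) @^-1` B))%E.
Proof.
move=> u0 ndu mA mB.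
have key (B' : set R) : measurable B' ->
  P (\bigcap_(i < m) (increment W (u i) (u i.+1) @^-1` A i) `&`
     increment W (u m) (u m.+1) @^-1` B') =
  ((\prod_(i < m) P (increment W (u i) (u i.+1) @^-1` A i)) *
   P (increment W (u m) (u m.+1) @^-1` B'))%E.
  move=> mB'.
  have := @bm_independent_increments _ _ _ _ _ hW m.+1 u u0 ndu.
  move=> /(_ (fun i : 'I_m.+1 => if (i < m)%N then A i else B')).
  rewrite big_ord_recr/= ltnn.
  under eq_bigr do rewrite ltn_ord.
  move=> <-; last by move=> i; case: ifP.
  congr (P _); apply/seteqP; split => [w [/= wA wB] i _|w /= wA].
    have [im|im] := ltnP i m; first exact: wA.
    by have -> : i = m :> nat by apply/eqP; rewrite eqn_leq im -ltnS ltn_ord.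
  split => [i /= im|].
    by have := wA (widen_ord (leqnSn m) (Ordinal im)) I; rewrite /= im.
  by have := wA ord_max I; rewrite /= ltnn.
(* Taking the last set to be [setT] in [key] identifies the product with the probability of the
   intersection. *)
rewrite key//; congr (_ * _)%E.
have := key setT measurableT; rewrite !preimage_setT setIT probability_setT.
by rewrite mule1 => ->.
Qed.

(** For fixed [B], both sides are finite measures in [E] that agree on the pi-system [G], hence on
    the sigma-algebra it generates. *)
Lemma independent_of_generated (G : set (set T)) (E : set T) (X : T -> R) (B : set R) :
  measurable_fun setT X -> measurable B -> G `<=` measurable -> setI_closed G ->
  G setT ->
  (forall A, G A -> P (A `&` X @^-1` B) = (P A * P (X @^-1` B))%E) ->
  <<s G >> E -> P (E `&` X @^-1` B) = (P E * P (X @^-1` B))%E.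
Proof.
move=> mX mB Gm GI GT GP GE.
have mXB : measurable (X @^-1` B) by rewrite -[X in measurable X]setTI; exact: mX.
have c0 : 0 <= fine (P (X @^-1` B)) by exact: fine_ge0.
have -> : (P E * P (X @^-1` B) = mscale (NngNum c0) P E)%E.
  by rewrite /mscale /= fineK ?fin_num_measure// muleC.
apply: (@g_sigma_algebra_measure_unique _ _ _ G Gm (fun=> setT) _ _
  (mrestr P mXB) (mscale (NngNum c0) P)) => //.
- by rewrite bigcup_const.
- move=> A GA; transitivity (P A * P (X @^-1` B))%E; first exact: GP.
  by rewrite /= /mscale/= fineK ?fin_num_measure// muleC.
- move=> _; apply: (@le_lt_trans _ _ 1%E); last exact: ltry.
  by apply: probability_le1; exact: measurableI.
Qed.

(* A pi-system that generates the sigma-algebra of the past of [s]. *)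
Definition past (s : R) : set (set T) :=
  [set E | exists (q : seq R) (C : R -> set R),
    [/\ forall r, r \in q -> 0 <= r <= s, forall r, measurable (C r) &
        E = [set w | forall r, r \in q -> C r (W r w)]]].

Lemma past_measurable s : past s `<=` measurable.
Proof.
move=> _ [q [C [_ mC ->]]].
rewrite (_ : [set _ | _] = \bigcap_(r in [set` q]) (W r @^-1` C r)).
  apply: fin_bigcap_measurable => // r _.
  rewrite -[X in measurable X]setTI; exact: measurable_funP.
by apply/seteqP; split => w /=.
Qed.

Lemma past_setI s : setI_closed (past s).
Proof.
move=> _ _ [q [C [q0 mC ->]]] [q' [C' [q'0 mC' ->]]].
exists (q ++ q').
exists (fun r => (if r \in q then C r else setT) `&` (if r \in q' then C' r else setT)).
split.
- by move=> r; rewrite mem_cat => /orP[/q0|/q'0].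
- by move=> r; apply: measurableI; case: ifPn.
- apply/seteqP; split => [w /= [h h'] r _|w /= h].
    by split; [case: ifPn => // /h|case: ifPn => // /h'].
  split => r rq; have := h r; rewrite mem_cat rq ?orbT => /(_ isT).
    by case.
  by case.
Qed.

Lemma past_setT s : past s setT.
Proof.
by exists [::], (fun=> setT); split => //; apply/seteqP; split.
Qed.

Lemma past_sub s t : s <= t -> past s `<=` past t.
Proof.
move=> st _ [q [C [q0 mC ->]]]; exists q, C; split => // r /q0 /andP[-> /=].
by move=> /le_trans; apply.
Qed.

Lemma past_value r s (C : set R) : 0 <= r <= s -> measurable C -> past s (W r @^-1` C).
Proof.
move=> rs mC; exists [:: r], (fun=> C); split => //.
- by move=> r'; rewrite inE => /eqP ->.
- apply/seteqP; split => [w /= Cw r'|w /=]; first by rewrite inE => /eqP ->.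
  by apply; rewrite inE.
Qed.

(** Independence is assumed for increments over ordered times, whereas the past is generated by
    values of [W] at arbitrary finite sets of times. Each value is a sum of increments along a
    sorted grid, so the pi-system argument runs twice: over the cylinder sets and, for each of them,
    over the product sets of the increments of its grid. *)
Lemma past_independent s t (E : set T) (B : set R) : 0 <= s -> s <= t ->
  <<s past s >> E -> measurable B ->
  P (E `&` increment W s t @^-1` B) = (P E * P (increment W s t @^-1` B))%E.
Proof.
move=> s0 st sE mB.
apply: (@independent_of_generated (past s) _ _ _ (measurable_increment s t) mB
  (@past_measurable s) (@past_setI s) (past_setT s) _ sE).
move=> {E sE} _ [q [C [q0s mC ->]]].
(* [0] is prepended so that every value is a sum of increments, [W] vanishing there; [s] is appended
   so that the grid ends where the tested increment starts. *)
pose L := 0 :: rcons (sort <=%R q) s.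
have sL : size L = (size q).+2 by rewrite /= size_rcons size_sort.
have srt : sorted <=%R L.
  rewrite /= rcons_path; apply/andP; split.
    rewrite path_min_sorted ?sort_le_sorted//.
    by apply/allP => r; rewrite mem_sort => /q0s /andP[].
  have := mem_last 0 (sort <=%R q); rewrite inE => /predU1P[->//|].
  by rewrite mem_sort => /q0s /andP[].
have Ls r : r \in L -> r <= s.
  rewrite inE mem_rcons inE mem_sort => /predU1P[->//|/predU1P[->//|/q0s]].
  by case/andP.
(* The default value [t] makes the increment after the last grid point [s] the one from [s] to [t],
   and keeps the sequence nondecreasing. *)
pose u i := nth t L i.
have ndu : nondecreasing_seq u.
  apply/nondecreasing_seqP => i; rewrite /u.
  have [iL|iL] := ltnP i.+1 (size L); last first.
    rewrite [leRHS]nth_default//.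
    have [iL'|iL'] := ltnP i (size L); last by rewrite nth_default.
    by apply: le_trans st; apply: Ls; rewrite mem_nth.
  by apply: (sorted_leq_nth le_trans lexx) => //; rewrite inE// ltnW.
pose m := (size q).+1.
have um : u m = s by rewrite /u /m /= nth_rcons size_sort ltnn eqxx.
have um1 : u m.+1 = t by rewrite /u nth_default// sL.
pose inc i := increment W (u i) (u i.+1).
pose G := [set E | exists A : nat -> set R,
  (forall i, measurable (A i)) /\ E = \bigcap_(i < m) (inc i @^-1` A i)].
have minc i : measurable_fun setT (inc i) by exact: measurable_increment.
apply: (@independent_of_generated G _ _ _ (measurable_increment s t) mB).
- move=> _ [A [mA ->]]; apply: fin_bigcap_measurable => // i _.
  by rewrite -[X in measurable X]setTI; exact: minc.
- move=> _ _ [A [mA ->]] [A' [mA' ->]]; exists (fun i => A i `&` A' i).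
  by split => [i|]; [exact: measurableI|rewrite -bigcapI].
- exists (fun=> setT); split => //; apply/seteqP; split => //.
- move=> _ [A [mA ->]].
  have := @independent_last_increment u m A B (lexx _) ndu mA mB.
  by rewrite um um1.
pose GT := g_sigma_algebraType G.
have mWu i : (i <= m)%N -> measurable_fun setT (W (u i) : GT -> R).
  move=> im; rewrite (_ : W (u i) = (fun w => \sum_(j < i) inc j w) :> (T -> R)).
    apply: (@measurable_sum _ GT R setT _ _ (fun (j : 'I_i) w => inc j w)) => j _ B' mB'.
    rewrite setTI; apply: sub_sigma_algebra.
    exists (fun k : nat => if k == j :> nat then B' else setT); split; first by move=> k; case: ifP.
    apply/seteqP; split => [w /= wB k _|w /= /(_ j)].
      by case: eqP => [->|].
    by rewrite eqxx; apply; rewrite /= (leq_trans (ltn_ord j)).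
  apply/funext => w.
  rewrite -(big_mkord xpredT (fun j => W (u j.+1) w - W (u j) w)).
  by rewrite telescope_sumr// [u 0%N]/= (bm_start hW) subr0.
rewrite (_ : [set _ | _] = \bigcap_(r in [set` q]) (W r @^-1` C r)); last first.
  by apply/seteqP; split.
apply: (@fin_bigcap_measurable _ GT) => // r rq.
rewrite -[X in measurable X]setTI.
have [i im <-] : exists2 i, (i <= m)%N & u i = r.
  exists (index r L); last by rewrite /u nth_index// inE mem_rcons inE mem_sort rq !orbT.
  rewrite -ltnS.
  by rewrite -[m.+1]/((size q).+2) -sL index_mem inE mem_rcons inE mem_sort rq !orbT.
exact: mWu.
Qed.

End brownian_past.

Section brownian_martingale.
Context (d : measure_display) (T : measurableType d) (R : realType)
  (P : probability T R) (W : R -> {RV P >-> R}).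
Hypothesis hW : standard_brownian_motion W.

Lemma expectation_product (Z X : {mfun T >-> R}) (y : R -> R) :
  (forall A B, measurable A -> measurable B ->
     P (Z @^-1` A `&` X @^-1` B) = (P (Z @^-1` A) * P (X @^-1` B))%E) ->
  (forall w, 0 <= Z w) -> measurable_fun setT y -> (forall x, 0 <= y x) ->
  (\int[P]_w (Z w * y (X w))%:E = \int[P]_w (Z w)%:E * \int[P]_w (y (X w))%:E)%E.
Proof.
move=> ZX Z0 my y0.
pose V w := (Z w, X w).
have mV : measurable_fun setT V by apply/measurable_fun_pairP; split; exact: measurable_funP.
pose VM := isMeasurableFun.Build _ _ T (R * R)%type _ mV.
pose V' : {mfun T >-> (R * R)%type} := HB.pack V VM.
(* The absolute value makes the integrand nonnegative on the whole plane, as Tonelli requires; on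
   the range of [Z] it changes nothing. *)
pose f (u : R * R) := (`|u.1| * y u.2)%:E.
have mf : measurable_fun setT f.
  apply/measurable_EFinP; apply: measurable_funM.
    by apply: measurableT_comp => //; exact: measurable_fst.
  by apply: measurableT_comp => //; exact: measurable_snd.
have f0 u : (0 <= f u)%E by rewrite lee_fin mulr_ge0.
transitivity (\int[distribution P V']_u f u)%E.
  rewrite ge0_integral_distribution//; apply: eq_integral => w _ /=.
  by rewrite /f /= ger0_norm.
transitivity (\int[distribution P Z \x distribution P X]_u f u)%E.
  apply: eq_measure_integral => A mA _; apply/esym.
  by apply: product_measure_unique => // B C mB mC; exact: ZX.
rewrite fubini_tonelli1//.
transitivity (\int[distribution P Z]_z (`|z|%:E * \int[distribution P X]_x (y x)%:E))%E.
  apply: eq_integral => z _; rewrite /fubini_F /f /=.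
  under eq_integral do rewrite EFinM.
  by rewrite ge0_integralZl//=; [exact/measurable_EFinP|by move=> x _; rewrite lee_fin].
have mn : measurable_fun setT (fun z : R => `|z|%:E).
  by apply/measurable_EFinP; exact: normr_measurable.
rewrite ge0_integralZr//.
- rewrite !ge0_integral_distribution//.
  + by congr (_ * _)%E; apply: eq_integral => w _ /=; rewrite ger0_norm.
  + exact/measurable_EFinP.
- by apply: integral_ge0 => x _; rewrite lee_fin.
Qed.

Definition expmart (a t : R) (w : T) : R := expR (- (a * W t w) - t * a ^+ 2 / 2).

Lemma measurable_expmart a t : measurable_fun setT (expmart a t).
Proof.
apply: measurableT_comp => //; apply: measurable_funB => //.
by apply: measurableT_comp => //; apply: measurable_funM => //; exact: measurable_funP.
Qed.

(** Conditional expectation is expressed through integrals over past events. The ratio of the values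
    at [t] and [s] is a function of the increment, hence independent of the past of [s], and has
    mean 1 by [increment_mgf]. *)
Lemma expmart_martingale a s t (E : set T) : 0 <= s -> s <= t ->
  <<s past W s >> E ->
  (\int[P]_(w in E) (expmart a t w)%:E = \int[P]_(w in E) (expmart a s w)%:E)%E.
Proof.
move=> s0 st sE.
pose PT := g_sigma_algebraType (past W s).
have subm A : <<s past W s >> A -> measurable A.
  by apply: (smallest_sub (@sigma_algebra_measurable _ T)); exact: past_measurable.
pose Z w := expmart a s w * \1_E w.
have mZ : measurable_fun setT (Z : PT -> R).
  apply: measurable_funM; last exact: measurable_indic.
  apply: measurableT_comp => //; apply: measurable_funB => //.
  apply: measurableT_comp => //; apply: measurable_funM => //.
  move=> _ B mB; rewrite setTI; apply: sub_sigma_algebra; apply: past_value => //.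
  by rewrite s0 lexx.
have mZ' : measurable_fun setT (Z : T -> R).
  by move=> mT B mB; apply: subm; exact: mZ.
pose ZM := isMeasurableFun.Build _ _ T R _ mZ'.
pose Z' : {mfun T >-> R} := HB.pack Z ZM.
pose XM := isMeasurableFun.Build _ _ T R _ (measurable_increment W s t).
pose X : {mfun T >-> R} := HB.pack (increment W s t) XM.
pose c := (t - s) * a ^+ 2 / 2.
have := @expectation_product Z' X (fun x => expR (- c) * expR (- (a * x))).
move=> prodE.
rewrite integral_mkcond [RHS]integral_mkcond.
transitivity (\int[P]_w (Z' w * (expR (- c) * expR (- (a * X w))))%:E)%E.
  apply: eq_integral => w _; rewrite patchE /= /Z indicE.
  case: (w \in E); last by rewrite mulr0 mul0r.
  rewrite mulr1 /expmart -!expRD /X /= /increment /c; congr (expR _)%:E.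
  by rewrite /=; field.
rewrite prodE; first last.
- by move=> x; rewrite mulr_ge0// expR_ge0.
- apply: measurable_funM => //; apply: measurableT_comp => //.
  by apply: measurableT_comp => //; exact: measurable_funM.
- by move=> w; rewrite /= /Z mulr_ge0// expR_ge0.
- move=> A B mA mB; apply: past_independent => //.
  by have := mZ measurableT A mA; rewrite setTI.
under [X in (_ * X)%E]eq_integral do rewrite EFinM.
rewrite ge0_integralZl ?lee_fin ?expR_ge0//; last first.
  apply/measurable_EFinP; apply: measurableT_comp => //.
  by apply: measurableT_comp => //; apply: measurable_funM => //; exact: measurable_funP.
rewrite increment_mgf// -EFinM -expRD addNr expR0 mule1.
apply: eq_integral => w _; rewrite patchE /= /Z indicE.
by case: (w \in E); rewrite ?mulr1 ?mulr0.
Qed.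

Lemma expmart_expectation a t : 0 <= t -> (\int[P]_w (expmart a t w)%:E = 1)%E.
Proof.
move=> t0.
rewrite (@expmart_martingale a 0 t setT)//; last first.
  by apply: sub_sigma_algebra; exact: past_setT.
under eq_integral do rewrite /expmart (bm_start hW) mulr0 !mul0r oppr0 addr0 expR0.
by rewrite integral_cst// mul1e; exact: probability_setT.
Qed.

End brownian_martingale.

(** * First zero of a continuous path on the half-line *)

Section first_zero.
Context {R : realType} (h : R -> R).
Hypothesis hc : {within `[0, +oo[, continuous h}.
Hypothesis h0 : 0 < h 0.

Lemma within_continuous_half_line t e : 0 <= t -> 0 < e ->
  exists2 del, 0 < del & forall r, 0 <= r -> `|t - r| < del -> `|h t - h r| < e.
Proof.
move=> t0 e0.
have /continuous_within_itvcyP[hi hr] := hc.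
have : \forall r \near t, 0 <= r -> `|h t - h r| < e.
  move: t0; rewrite le_eqVlt => /predU1P[<-|t0].
    move: hr => /cvgrPdist_lt /(_ _ e0) [del /= del0 H]; exists del => //= r rdel.
    rewrite le_eqVlt => /predU1P[<-|r0]; first by rewrite subrr normr0.
    exact: H.
  have : h r @[r --> t] --> h t by apply: hi; rewrite in_itv/= t0.
  by move=> /cvgrPdist_lt /(_ _ e0); apply: filterS => r + _.
move=> [del /= del0 H]; exists del => // r r0 rdel.
exact: H.
Qed.

Let S := [set t | 0 < t /\ h t <= 0].

Lemma inf_zero_set : S !=set0 -> exists r, [/\ 0 < r, h r = 0, S r & lbound S r].
Proof.
move=> S0.
have lS : has_lbound S by exists 0 => t [/ltW].
have hS : has_inf S by split.
pose r := inf S.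
have lr : lbound S r by move=> t St; exact: ge_inf.
have r_ge0 : 0 <= r by apply: lb_le_inf => // t [/ltW].
have adh e : 0 < e -> exists2 t, S t & t < r + e by move=> e0; exact: (inf_adherent e0 hS).
have hr : h r <= 0.
  rewrite leNgt; apply/negP => hr0.
  have [del del0 H] := within_continuous_half_line r_ge0 hr0.
  have [t St tr] := adh _ del0; have [t0 ht] := St.
  have rt := lr _ St.
  have := H t (ltW t0); rewrite ler0_norm ?subr_le0// opprB ltrBlDl => /(_ tr).
  by rewrite ltr_norml => /andP[_]; rewrite ltrBlDl -ltrBlDr subrr ltNge ht.
have r0 : 0 < r.
  by rewrite lt_neqAle r_ge0 andbT; apply/eqP => r0; move: hr; rewrite -r0 leNgt h0.
exists r; split => //.
apply/eqP; rewrite eq_le hr leNgt /=; apply/negP => hr0.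
have hr0' : 0 < - h r by rewrite oppr_gt0.
have [del del0 H] := within_continuous_half_line r_ge0 hr0'.
(* A point just before [r]: the second term keeps it within [del] of [r], the first keeps it
   positive, as membership in [S] demands. *)
pose t := Num.max (r / 2) (r - del / 2).
have tr : t < r by rewrite /t gt_max; apply/andP; split; lra.
have t0 : 0 < t by rewrite /t lt_max divr_gt0.
have tdel : `|r - t| < del.
  rewrite ger0_norm; last by rewrite subr_ge0 ltW.
  have : r - del / 2 <= t by rewrite /t le_max lexx orbT.
  lra.
have := H _ (ltW t0) tdel.
rewrite ltr_norml => /andP[+ _]; rewrite opprK => ht.
have : S t by split => //; lra.
by move=> /lr; rewrite leNgt tr.
Qed.

Lemma ereal_inf_le_zero_set s :
  (ereal_inf (EFin @` S) <= s%:E)%E <-> exists t, 0 < t <= s /\ h t <= 0.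
Proof.
split; last first.
  move=> [t [/andP[t0 ts] ht]]; apply: (@le_trans _ _ t%:E); last by rewrite lee_fin.
  by apply: ereal_inf_lbound; exists t.
have [->|/set0P S0] := eqVneq S set0; first by rewrite image_set0 ereal_inf0.
have [r [r0 hr Sr lr]] := inf_zero_set S0.
move=> rs; exists r; split; last by rewrite hr.
rewrite r0 /= -lee_fin; apply: le_trans rs.
by apply: le_ereal_inf_tmp => _ [t St <-]; rewrite lee_fin; exact: lr.
Qed.

Lemma ereal_inf_zero_set s :
  (ereal_inf (EFin @` S) <= s%:E)%E ->
  exists r, [/\ 0 < r <= s, h r = 0 & ereal_inf (EFin @` S) = r%:E].
Proof.
move=> infs; have [t [/andP[t0 ts] ht]] := (ereal_inf_le_zero_set s).1 infs.
have [|r [r0 hr Sr lr]] := inf_zero_set; first by exists t.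
have -> : ereal_inf (EFin @` S) = r%:E.
  apply/eqP; rewrite eq_le; apply/andP; split.
    by apply: ereal_inf_lbound; exists r.
  by apply: le_ereal_inf_tmp => _ [u Su <-]; rewrite lee_fin; exact: lr.
by exists r; split => //; rewrite r0 (le_trans _ ts)//; apply: lr.
Qed.

(** This countable description is what places passage before [s] in the past of [s]. The slack is
    there because [h] need not be nonpositive at any rational. Conversely, the minimum over the
    compact [[0, s]] is at most 0, and [h 0 > 0] keeps the minimiser away from 0. *)
Lemma zero_set_rat s :
  (exists t, 0 < t <= s /\ h t <= 0) <->
  (forall k : nat, exists q : rat, (0 <= (ratr q : R) <= s) /\ h (ratr q) < k.+1%:R^-1).
Proof.
split.
  move=> [t [/andP[t0 ts] ht]] k.
  have k0 : 0 < k.+1%:R^-1 :> R by rewrite invr_gt0.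
  have [del del0 H] := within_continuous_half_line (ltW t0) k0.
  (* The rational is chosen below [t], so that it stays in [[0, s]] even if [t = s]. *)
  have : Num.max 0 (t - del) < t by rewrite gt_max t0/=; lra.
  move=> /rat_in_itvoo[q]; rewrite in_itv/= gt_max => /andP[/andP[q0 qdel] qt].
  exists q; split; first by rewrite (ltW q0) (le_trans (ltW qt)).
  have := H _ (ltW q0); rewrite gtr0_norm ?subr_gt0// ltrBlDl -ltrBlDr => /(_ qdel).
  rewrite ltr_norml => /andP[hq _].
  by rewrite -[ltRHS]add0r -ltrBlDr; apply: lt_le_trans ht; rewrite -ltrBrDl.
move=> H.
have s0 : 0 <= s by have [q [/andP[q0 qs] _]] := H 0%N; exact: le_trans qs.
have [|c /[!in_itv]/= /andP[c0 cs] hcmin] := @EVT_min R h 0 s s0.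
  apply: continuous_subspaceW hc => t /=; rewrite !in_itv/= => /andP[->//].
have hc0 : h c <= 0.
  apply/ler_addgt0Pl => e e0; rewrite addr0.
  have [k ke] : exists k : nat, k.+1%:R^-1 < e.
    by have /ltr_add_invr[k] := e0; rewrite add0r; exists k.
  have [q [qs hq]] := H k.
  by apply: le_trans (ltW ke); apply: le_trans (ltW hq); apply: hcmin; rewrite in_itv.
exists c; split => //; rewrite cs andbT lt_neqAle c0 andbT.
by apply/eqP => c0'; move: hc0; rewrite -c0' leNgt h0.
Qed.

End first_zero.

Lemma ler_dist_minl (R : realType) (u v K : R) :
  `|Num.min u K - Num.min v K| <= `|u - v|.
Proof.
rewrite /Num.min; case: ifP => h1; case: ifP => h2; rewrite ?subrr ?normr_ge0//.
all: rewrite ler_norml; apply/andP; have := ler_norm (u - v).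
all: by have := ler_norm (v - u); rewrite distrC => H1 H2; split; lra.
Qed.

(** * First passage of the Brownian path *)

Section first_passage.
Context (d : measure_display) (T : measurableType d) (R : realType)
  (P : probability T R) (W : R -> {RV P >-> R}).
Hypothesis hW : standard_brownian_motion W.
Variables (b : R -> R).
Hypothesis hb0 : b 0 = 0.
Hypothesis hbc : {within `[0, +oo[, continuous b}.
Variable x : R.
Hypothesis x0 : 0 < x.

Local Notation tau := (first_passage_time W b x).

Let h w (t : R) := W t w + x - b t.

Let hc w : {within `[0, +oo[, continuous (h w)}.
Proof.
apply: within_continuousB; last exact: hbc.
apply: within_continuousD; first exact: (@bm_continuous _ _ _ _ _ hW w).
by move=> t; exact: cvg_cst.
Qed.

Let h0 w : 0 < h w 0.
Proof. by rewrite /h (bm_start hW) hb0 add0r subr0. Qed.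

Let tauE w : tau w = ereal_inf (EFin @` [set t | 0 < t /\ h w t <= 0]).
Proof.
rewrite /first_passage_time; congr (ereal_inf (_ @` _)).
by apply/seteqP; split => t /= [t0]; rewrite /h subr_le0.
Qed.

Definition hit (s : R) : set T := [set w | (tau w <= s%:E)%E].

Lemma sub_hit s t : s <= t -> hit s `<=` hit t.
Proof. by move=> st w /= /le_trans; apply; rewrite lee_fin. Qed.

Lemma hit_le0 s : s <= 0 -> hit s = set0.
Proof.
move=> s0; apply/seteqP; split => // w /=.
rewrite /hit/= tauE => /(ereal_inf_le_zero_set (@hc w) (h0 w))[t [/andP[t0 ts] _]].
by move: t0; rewrite ltNge (le_trans ts).
Qed.

Lemma hit_past s : <<s past W s >> (hit s).
Proof.
pose PT := g_sigma_algebraType (past W s).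
pose F (k : nat) (q : rat) : set T :=
  [set w | 0 <= (ratr q : R) <= s /\ h w (ratr q) < k.+1%:R^-1].
rewrite (_ : hit s = \bigcap_k \bigcup_q F k q); last first.
  apply/seteqP; split => w.
    rewrite /hit/= tauE => /(ereal_inf_le_zero_set (@hc w) (h0 w)).
    move=> /(zero_set_rat (@hc w) (h0 w)) H k _.
    by have [q] := H k; exists q.
  move=> H; rewrite /hit/= tauE.
  apply/(ereal_inf_le_zero_set (@hc w) (h0 w)).
  apply/(zero_set_rat (@hc w) (h0 w)) => k.
  by have [q _] := H k I; exists q.
apply: (@bigcapT_measurable _ PT) => k.
apply: (@bigcupT_measurable_rat _ PT) => q.
have [qs|qs] := boolP (0 <= (ratr q : R) <= s); last first.
  rewrite (_ : F k q = set0); first exact: (@measurable0 _ PT).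
  by apply/seteqP; split => // w [/= qs' _]; rewrite qs' in qs.
apply: sub_sigma_algebra.
rewrite (_ : F k q = W (ratr q) @^-1` [set y | y + x - b (ratr q) < k.+1%:R^-1]); last first.
  by apply/seteqP; split => w; [case|split].
apply: past_value => //.
rewrite (_ : [set _ | _] = `]-oo, (k.+1%:R^-1 + b (ratr q) - x)[%classic).
  exact: measurable_itv.
by apply/seteqP; split => y /=; rewrite in_itv/= ltrBlDr ltrBrDr.
Qed.

Lemma measurable_hit s : measurable (hit s).
Proof.
move: (@hit_past s); apply: (smallest_sub (@sigma_algebra_measurable _ T)).
exact: past_measurable.
Qed.

Lemma hitP s w : hit s w ->
  exists r, [/\ 0 < r <= s, W r w = b r - x & tau w = r%:E].
Proof.
rewrite /hit/= tauE => /(ereal_inf_zero_set (@hc w) (h0 w))[r [rs hr ->]].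
by exists r; split => //; move: hr; rewrite /h => ?; lra.
Qed.

Lemma not_hit s w : 0 < s -> ~ hit s w -> b s - x < W s w.
Proof.
move=> s0 H; rewrite ltNge; apply/negP => Ws; apply: H.
rewrite /hit/= tauE; apply/(ereal_inf_le_zero_set (@hc w) (h0 w)).
by exists s; rewrite s0 lexx; split => //; rewrite /h; lra.
Qed.

Lemma measurable_first_passage_time : measurable_fun setT tau.
Proof.
apply: (measurability _ (ErealGenOInfty.measurableE R)).
move=> _ [_ [r ->] <-]; rewrite setTI.
rewrite (_ : _ @^-1` _ = ~` hit r); first exact/measurableC/measurable_hit.
apply/seteqP; split => w; rewrite /hit /= in_itv/= andbT ltNge.
  by move/negP.
by move/negP.
Qed.

(** * Optional stopping at the passage time *)

Section stopping.
Variables (N : R).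
Hypothesis N0 : 0 < N.

Let tg n i : R := N * i%:R / n.+1%:R.
Let A n i := hit (tg n i.+1) `\` hit (tg n i).

Let tgS n i : tg n i <= tg n i.+1.
Proof. by rewrite /tg ler_pM2r// ler_pM2l// ler_nat. Qed.

Let tg_ge0 n i : 0 <= tg n i.
Proof. by rewrite /tg mulr_ge0// mulr_ge0// ltW. Qed.

Let tg_leN n i : (i <= n.+1)%N -> tg n i <= N.
Proof.
by move=> iN; rewrite /tg ler_pdivrMr// ler_pM2l// ler_nat.
Qed.

Let mA n i : measurable (A n i).
Proof. by apply: measurableD; exact: measurable_hit. Qed.

Let sum_indic n w : \sum_(i < n.+1) \1_(A n i) w = \1_(hit N) w :> R.
Proof.
transitivity (\sum_(i < n.+1) (\1_(hit (tg n i.+1)) w - \1_(hit (tg n i)) w) : R).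
  apply: eq_bigr => i _; rewrite /A !indicE in_setD.
  have [wi|wi] := boolP (w \in hit (tg n i)); last by rewrite andbT subr0.
  have -> : w \in hit (tg n i.+1).
    by move: wi; rewrite !inE; exact: sub_hit.
  by rewrite /= subrr.
rewrite -(big_mkord xpredT (fun i => \1_(hit (tg n i.+1)) w - \1_(hit (tg n i)) w)).
have t0 : tg n 0 = 0 by rewrite /tg mulr0 mul0r.
have tN : tg n n.+1 = N by rewrite /tg mulfK// pnatr_eq0.
have hit0 : hit 0 = set0 by exact: hit_le0.
rewrite telescope_sumr// t0 tN hit0.
by rewrite indic0 subr0.
Qed.

Let sum_integral n (g : T -> R) : measurable_fun setT g -> (forall w, 0 <= g w) ->
  (\sum_(j < n.+1) \int[P]_(w in A n j) (g w)%:E = \int[P]_(w in hit N) (g w)%:E)%E.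
Proof.
move=> mg g0; rewrite -(@integral_sum_indic _ _ _ P (fun=> g) (A n) n.+1
  (fun=> mg) (fun=> g0) (@mA n)).
rewrite [RHS]integral_mkcond; apply: eq_integral => w _.
rewrite -mulr_sumr sum_indic patchE indicE.
by case: (w \in hit N); rewrite ?mulr1 ?mulr0.
Qed.

(** Optional stopping on the grid: rounding up rather than down puts [A n j] in the past of
    [tg n j.+1], so on each cell the martingale property moves the time to [N]. *)
Let sum_expmart (a : R) n :
  (\int[P]_w (\sum_(j < n.+1) expmart W a (tg n j.+1) w * \1_(A n j) w)%:E =
   \int[P]_(w in hit N) (expmart W a N w)%:E)%E.
Proof.
rewrite (@integral_sum_indic _ _ _ P (fun j => expmart W a (tg n j.+1)) (A n))//; last 2 first.
- by move=> j; exact: measurable_expmart.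
- by move=> j w; exact: expR_ge0.
rewrite -(sum_integral n)//; last 2 first.
- exact: measurable_expmart.
- by move=> w; exact: expR_ge0.
apply: eq_bigr => j _; apply/esym/expmart_martingale => //.
- exact: tg_leN.
- pose PT := g_sigma_algebraType (past W (tg n j.+1)).
  apply: (@measurableD _ PT); first exact: hit_past.
  by apply: sub_sigma_algebra2 (@hit_past _); exact: past_sub.
Qed.

(* [b] is only constrained on [0, +oo[; this version is measurable on [R]. *)
Let b' := b \_ `]0, +oo[.

Let mb' : measurable_fun setT b'.
Proof.
apply/(measurable_restrictT _ _).1 => //.
apply: subspace_continuous_measurable_fun => //.
by apply: continuous_subspaceW hbc => t /=; rewrite !in_itv/= !andbT => /ltW.
Qed.

(** The exponential martingale at a time [t > 0] at which the path is on the boundary,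
    [W t = b t - x]. *)
Definition stopped_value (a t : R) : R :=
  expR (- (a * (b' t - x)) - t * a ^+ 2 / 2).

Lemma measurable_stopped_value a : measurable_fun setT (stopped_value a).
Proof.
apply: measurableT_comp => //; apply: measurable_funB => //.
  apply: measurableT_comp => //; apply: measurable_funM => //.
  exact: measurable_funB.
by apply: measurable_funM => //; apply: measurable_funM.
Qed.

Lemma stopped_valueE a r w : 0 < r -> W r w = b r - x ->
  expmart W a r w = stopped_value a r.
Proof.
by move=> r0 Wr; rewrite /expmart /stopped_value /b' patchE mem_setE in_itv/= r0 Wr.
Qed.

Let mtau : measurable_fun setT (fine \o tau).
Proof.
by apply: measurableT_comp; [exact: fine_measurable|exact: measurable_first_passage_time].
Qed.

(* [U] is the value of the exponential martingale at the passage time rounded up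
   to the [n]-th grid, truncated at [K]. *)
Let U a K n w : R :=
  \sum_(j < n.+1) Num.min (expmart W a (tg n j.+1) w) K * \1_(A n j) w.
Let L a K w : R := Num.min (stopped_value a (fine (tau w))) K * \1_(hit N) w.

Let U_cvg a K w : U a K n w @[n --> \oo] --> L a K w.
Proof.
have [wN|wN] := boolP (w \in hit N); last first.
  rewrite (_ : (fun n => _) = cst (L a K w)); first exact: cvg_cst.
  apply/funext => n /=; rewrite /U /L indicE (negbTE wN) mulr0 big1// => j _.
  rewrite indicE memNset ?mulr0// => -[wj _]; move/negP: wN; apply; rewrite inE.
  by apply: (@sub_hit (tg n j.+1) N _ w wj); exact: tg_leN.
have [r [/andP[r0 rN] Wr taur]] := hitP (set_mem wN).
rewrite /L taur /= indicE wN mulr1 -(stopped_valueE a r0 Wr).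
apply/cvgrPdist_le => e e0.
have cM : {within `[0, +oo[, continuous (fun t => expmart W a t w)}.
  have cW : {within `[0, +oo[, continuous (fun t => W t w)} :=
    @bm_continuous _ _ _ _ _ hW w.
  have c1 : {within `[0, +oo[, continuous (fun t => - (a * W t w))}.
    by move=> t; apply: cvgN; apply: cvgM; [exact: cvg_cst|exact: cW].
  have c2 : {within `[0, +oo[, continuous (fun t : R => t * a ^+ 2 / 2)}.
    apply: continuous_subspaceT => t; apply: cvgM; last exact: cvg_cst.
    by apply: cvgM; [exact: cvg_id|exact: cvg_cst].
  have c12 := within_continuousB c1 c2.
  move=> t; exact: (continuous_comp (c12 t) (@continuous_expR R _)).
have [del del0 H] := within_continuous_half_line cM (ltW r0) e0.
have [n0 n0del] : exists n0 : nat, N / n0.+1%:R < del.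
  have /ltr_add_invr[k] : 0 < del / N by rewrite divr_gt0.
  by rewrite add0r => kdel; exists k; rewrite -ltr_pdivlMl// mulrC.
near=> n.
have ndel : N / n.+1%:R < del.
  apply: le_lt_trans n0del; rewrite ler_pM2l// lef_pV2 ?posrE// ler_nat ltnS.
  by near: n; exists n0.
rewrite /U -[leRHS]mulr1.
have -> : Num.min (expmart W a r w) K =
    \sum_(j < n.+1) Num.min (expmart W a r w) K * \1_(A n j) w.
  by rewrite -mulr_sumr sum_indic indicE wN mulr1.
rewrite -sumrB.
have -> : 1 = \sum_(j < n.+1) \1_(A n j) w :> R by rewrite sum_indic indicE wN.
rewrite mulr_sumr; apply: le_trans (ler_norm_sum _ _ _) _; apply: ler_sum => j _.
rewrite -mulrBl normrM [X in _ * X]ger0_norm//.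
rewrite !indicE; have [/set_mem[wj1 wj]|_] := boolP (w \in A n j); last by rewrite !mulr0.
rewrite !mulr1.
have rj : r <= tg n j.+1 by move: wj1; rewrite /hit/= taur lee_fin.
have jr : tg n j < r by move/negP: wj; rewrite /hit/= taur lee_fin ltNge.
have jj : tg n j.+1 - tg n j = N / n.+1%:R.
  by rewrite /tg -!mulrA -mulrBr -mulrBl -natrB// subSnn mul1r.
have : `|expmart W a r w - expmart W a (tg n j.+1) w| < e.
  apply: H => //; rewrite ler0_norm ?subr_le0// opprB.
  by apply: le_lt_trans ndel; rewrite -jj lerD2l lerN2 ltW.
move=> /ltW; apply: le_trans.
exact: ler_dist_minl.
Unshelve. all: by end_near.
Qed.

Let mU a K n : measurable_fun setT (U a K n).
Proof.
apply: measurable_sum => j; apply: measurable_funM; last exact: measurable_indic.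
by apply: measurable_minr => //; exact: measurable_expmart.
Qed.

Let U_ge0 a K n w : 0 <= K -> 0 <= U a K n w.
Proof.
move=> K0; apply: sumr_ge0 => j _; rewrite mulr_ge0//.
by rewrite le_min K0 expR_ge0.
Qed.

Let U_leK a K n w : 0 <= K -> U a K n w <= K.
Proof.
move=> K0; apply: (@le_trans _ _ (\sum_(j < n.+1) K * \1_(A n j) w)).
  by apply: ler_sum => j _; rewrite ler_wpM2r// ge_min lexx orbT.
by rewrite -mulr_sumr sum_indic ler_piMr.
Qed.

(* On [0, N] the square of the exponential martingale with parameter [a] is at
   most [expR (N * a ^+ 2)] times the one with parameter [2 * a], whose
   expectation is 1: this bounds the truncation error uniformly in the grid. *)
Let expmart_minD a K t w : 0 < K -> t <= N -> expmart W a t w <=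
  Num.min (expmart W a t w) K + expR (N * a ^+ 2) / K * expmart W (a *+ 2) t w.
Proof.
move=> K0 tN; have [mK|Km] := leP (expmart W a t w) K.
  by rewrite lerDl mulr_ge0 ?expR_ge0// divr_ge0 ?expR_ge0// ltW.
apply: (@le_trans _ _ (expR (N * a ^+ 2) / K * expmart W (a *+ 2) t w)); last first.
  by rewrite lerDr ltW.
rewrite mulrAC ler_pdivlMr//.
apply: (@le_trans _ _ (expmart W a t w * expmart W a t w)).
  by rewrite ler_wpM2l ?expR_ge0// ltW.
rewrite /expmart -!expRD ler_expR -subr_ge0.
have -> : N * a ^+ 2 + (- (a *+ 2 * W t w) - t * (a *+ 2) ^+ 2 / 2) -
  (- (a * W t w) - t * a ^+ 2 / 2 + (- (a * W t w) - t * a ^+ 2 / 2)) =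
  (N - t) * a ^+ 2 by field.
by rewrite mulr_ge0 ?subr_ge0// sqr_ge0.
Qed.

Let expmart_hit_le1 a : (\int[P]_(w in hit N) (expmart W a N w)%:E <= 1)%E.
Proof.
rewrite -(expmart_expectation hW a (ltW N0)).
apply: ge0_subset_integral => //.
- exact: measurable_hit.
- by apply/measurable_EFinP; exact: measurable_expmart.
- by move=> w _; rewrite lee_fin expR_ge0.
Qed.

Let msum a n : measurable_fun setT
  (fun w => \sum_(j < n.+1) expmart W a (tg n j.+1) w * \1_(A n j) w).
Proof.
apply: measurable_sum => j; apply: measurable_funM; last exact: measurable_indic.
exact: measurable_expmart.
Qed.

Let integral_U_le a K n : 0 <= K ->
  (\int[P]_w (U a K n w)%:E <= \int[P]_(w in hit N) (expmart W a N w)%:E)%E.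
Proof.
move=> K0; rewrite -(sum_expmart a n); apply: ge0_le_integral => //.
- by move=> w _; rewrite lee_fin U_ge0.
- exact/measurable_EFinP.
- exact/measurable_EFinP.
- move=> w _; rewrite lee_fin; apply: ler_sum => j _.
  by rewrite ler_wpM2r// ge_min lexx.
Qed.

Let integral_U_ge a K n : 0 < K ->
  (\int[P]_(w in hit N) (expmart W a N w)%:E <=
   \int[P]_w (U a K n w)%:E + (expR (N * a ^+ 2) / K)%:E)%E.
Proof.
move=> K0; rewrite -(sum_expmart a n).
pose V w := \sum_(j < n.+1) expmart W (a *+ 2) (tg n j.+1) w * \1_(A n j) w.
have mV : measurable_fun setT V by exact: msum.
have V0 w : 0 <= V w.
  by apply: sumr_ge0 => j _; rewrite mulr_ge0// expR_ge0.
have c0 : 0 <= expR (N * a ^+ 2) / K by rewrite divr_ge0 ?expR_ge0// ltW.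
apply: (@le_trans _ _ (\int[P]_w ((U a K n w)%:E + (expR (N * a ^+ 2) / K)%:E * (V w)%:E)))%E.
  apply: ge0_le_integral => //.
  - by move=> w _; rewrite lee_fin sumr_ge0// => j _; rewrite mulr_ge0// expR_ge0.
  - exact/measurable_EFinP.
  - apply: emeasurable_funD; first exact/measurable_EFinP.
    by apply: measurable_funeM; exact/measurable_EFinP.
  - move=> w _; rewrite -EFinM -EFinD lee_fin /U /V mulr_sumr -big_split/=.
    apply: ler_sum => j _; rewrite mulrA -mulrDl ler_wpM2r//.
    by apply: expmart_minD => //; exact: tg_leN.
rewrite ge0_integralD//; last 4 first.
- by move=> w _; rewrite lee_fin U_ge0// ltW.
- exact/measurable_EFinP.
- by move=> w _; rewrite -EFinM lee_fin mulr_ge0.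
- by apply: measurable_funeM; exact/measurable_EFinP.
rewrite leeD2l// ge0_integralZl//; last 2 first.
- exact/measurable_EFinP.
- by move=> w _; rewrite lee_fin.
rewrite sum_expmart -[leRHS]mule1 lee_wpmul2l//.
Qed.

Let stopped_value_bounded a : exists B, forall t, 0 < t <= N -> stopped_value a t <= B.
Proof.
pose f t := expR (- (a * (b t - x)) - t * a ^+ 2 / 2).
have cf : {within `[0, N], continuous f}.
  have cb : {within `[0, N], continuous b}.
    by apply: continuous_subspaceW hbc => t /=; rewrite !in_itv/= => /andP[->].
  have c1 : {within `[0, N], continuous (fun t => - (a * (b t - x)))}.
    move=> t; apply: cvgN; apply: cvgM; first exact: cvg_cst.
    by apply: cvgB; [exact: cb|exact: cvg_cst].
  have c2 : {within `[0, N], continuous (fun t : R => t * a ^+ 2 / 2)}.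
    apply: continuous_subspaceT => t; apply: cvgM; last exact: cvg_cst.
    by apply: cvgM; [exact: cvg_id|exact: cvg_cst].
  have c12 := within_continuousB c1 c2.
  by move=> t; exact: (continuous_comp (c12 t) (@continuous_expR R _)).
have [c _ cmax] := EVT_max (ltW N0) cf.
exists (f c) => t /andP[t0 tN].
rewrite /stopped_value /b' patchE mem_setE in_itv/= t0/=.
by apply: cmax; rewrite in_itv/= (ltW t0).
Qed.

(** Truncation at [K] makes dominated convergence available. Once [K] reaches the bound of the
    stopped value on []0, N]], the limit is not truncated, and the error [expR (N * a ^+ 2) / K]
    does not depend on the grid, so [K] can be enlarged independently of [n]. *)
Lemma stopped_expectation a :
  (\int[P]_(w in hit N) (stopped_value a (fine (tau w)))%:E =
   \int[P]_(w in hit N) (expmart W a N w)%:E)%E.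
Proof.
have [B HB] := stopped_value_bounded a.
have mst : measurable_fun setT (fun w => stopped_value a (fine (tau w))).
  exact: (measurableT_comp (measurable_stopped_value a) mtau).
have cvgK K : B <= K -> 0 < K -> (\int[P]_w (U a K n w)%:E @[n --> \oo] -->
    \int[P]_(w in hit N) (stopped_value a (fine (tau w)))%:E)%E.
  move=> BK K0.
  rewrite (_ : (\int[P]_(w in hit N) (stopped_value a (fine (tau w)))%:E)%E =
    (\int[P]_w (L a K w)%:E)%E); last first.
    rewrite integral_mkcond; apply: eq_integral => w _; rewrite patchE /L indicE.
    case: (boolP (w \in hit N)) => [wN|_]; last by rewrite mulr0.
    have [r [rN _ taur]] := hitP (set_mem wN).
    by rewrite mulr1 taur/= min_l// (le_trans (HB _ rN)).
  have mL : measurable_fun setT (L a K).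
    apply: measurable_funM; last by apply: measurable_indic; exact: measurable_hit.
    exact: measurable_minr.
  have mUE n : measurable_fun setT (fun w => (U a K n w)%:E) by exact/measurable_EFinP.
  have mLE : measurable_fun setT (fun w => (L a K w)%:E) by exact/measurable_EFinP.
  have cU : {ae P, forall w, setT w -> (U a K n w)%:E @[n --> \oo] --> (L a K w)%:E}.
    by apply: aeW => w _; apply: cvg_EFin; [exact: nearW|exact: U_cvg].
  have bU : {ae P, forall w n, setT w -> (`|(U a K n w)%:E| <= K%:E)%E}.
    by apply: aeW => w n _; rewrite lee_fin ger0_norm ?U_ge0 ?U_leK// ltW.
  have iK : P.-integrable setT (fun=> K%:E) by exact: finite_measure_integrable_cst.
  by have [] := dominated_convergence measurableT mUE mLE cU iK bU.
apply/eqP; rewrite eq_le; apply/andP; split.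
  pose K := Num.max B 1.
  apply: (cvge_to_le (cvgK K _ _)).
  - by rewrite /K le_max lexx.
  - by rewrite /K lt_max ltr01 orbT.
  - by apply: nearW => n; apply: integral_U_le; rewrite /K le_max ler01 orbT.
apply/lee_addgt0Pr => e e0.
pose c := expR (N * a ^+ 2).
(* [B] leaves the limit untruncated, [1] makes [K] positive, and [c / e] brings the truncation error
   down to at most [e]. *)
pose K := Num.max B (Num.max 1 (c / e)).
have K0 : 0 < K by rewrite /K !lt_max ltr01 orbT.
have KB : B <= K by rewrite /K le_max lexx.
rewrite -leeBlDr//.
apply: (cvge_to_ge (cvgK K KB K0)).
apply: nearW => n; rewrite leeBlDr//; apply: le_trans (integral_U_ge a n K0) _.
have : c / e <= K by rewrite /K !le_max lexx !orbT.
by rewrite ler_pdivrMr// mulrC => ceK; rewrite leeD2l// lee_fin ler_pdivrMr.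
Qed.

End stopping.


(** * Law of the passage time and its weighted integral *)

Section density_of_first_passage.
Variable q : R -> R.
Hypothesis q0 : forall t, 0 < t -> 0 <= q t.
Hypothesis qc : {within `]0, +oo[, continuous q}.
Hypothesis qlaw : forall A : set R, measurable A ->
  P (tau @^-1` (EFin @` A)) =
  (\int[lebesgue_measure]_(t in A `&` `]0%R, +oo[) (q t)%:E)%E.

(** [fine] sends an infinite passage time to 0, so [P] is first restricted to [hit N], where [tau]
    is a real number in []0, N]]; under this restricted measure its law has density [q] on []0,
    N]]. *)
Lemma integral_hit_density N (phi : R -> R) :
  measurable_fun setT phi -> (forall t, 0 <= phi t) ->
  (\int[P]_(w in hit N) (phi (fine (tau w)))%:E =
   \int[lebesgue_measure]_(t in `]0%R, N]) (phi t * q t)%:E)%E.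
Proof.
move=> mphi phi0.
have mH := measurable_hit N.
pose th : T -> measurableTypeR R := fine \o tau.
have mth : measurable_fun setT th.
  by apply: measurableT_comp; [exact: fine_measurable|exact: measurable_first_passage_time].
pose thM := isMeasurableFun.Build _ _ T (measurableTypeR R) _ mth.
pose th' : {mfun T >-> measurableTypeR R} := HB.pack th thM.
have mphi' : measurable_fun (setT : set (measurableTypeR R)) (fun t => (phi t)%:E).
  exact/measurable_EFinP.
transitivity (\int[P]_w ((phi (th w))%:E * (\1_(hit N) w)%:E))%E.
  rewrite integral_mkcond; apply: eq_integral => w _; rewrite patchE indicE.
  by case: (w \in hit N); rewrite ?mule1 ?mule0.
transitivity (\int[mrestr P mH]_w (phi (th w))%:E)%E.
  apply/esym; apply: (@ge0_integral_density _ _ _ P (mrestr P mH) (\1_(hit N))) => //.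
  - by move=> B mB; rewrite integral_indic// setIC.
  - exact: (measurableT_comp mphi' mth).
  - by move=> w; rewrite lee_fin.
transitivity (\int[pushforward (mrestr P mH) th']_t (phi t)%:E)%E.
  by rewrite (ge0_integral_pushforward mth)// => t _; rewrite lee_fin.
have mq : measurable_fun (setT : set (measurableTypeR R)) (q \_ `]0, N]).
  apply/(measurable_restrictT _ _).1 => //.
  apply: subspace_continuous_measurable_fun => //.
  by apply: continuous_subspaceW qc => t /=; rewrite !in_itv/= andbT => /andP[].
transitivity (\int[lebesgue_measure]_t ((phi t)%:E * ((q \_ `]0, N]) t)%:E))%E.
  apply: (@ge0_integral_density _ (measurableTypeR R) R lebesgue_measure
    (pushforward (mrestr P mH) th')) => //.
  - move=> t; rewrite patchE; case: ifPn => //.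
    by rewrite mem_setE in_itv/= => /andP[/q0].
  - move=> B mB.
    transitivity (P (tau @^-1` (EFin @` (B `&` `]0, N])))).
      congr (P _); apply/seteqP; split => w.
        move=> [/= Bw wN]; have [r [rN _ taur]] := hitP wN.
        by exists r => //; split; [move: Bw; rewrite /th/= taur|rewrite /= in_itv].
      move=> [r [Br]] /=; rewrite in_itv/= => /andP[r0 rN] taur; split.
        by rewrite /= /th/= -taur.
      by rewrite /hit/= -taur lee_fin.
    rewrite qlaw; last exact: measurableI.
    rewrite -setIA integral_mkcondr; apply: eq_integral => t _.
    rewrite !patchE in_setI (_ : (t \in `]0, +oo[%classic) = (0 < t)); last first.
      by rewrite mem_setE in_itv/= andbT.
    rewrite mem_setE in_itv/=; case: ltP => //= t0; rewrite andbT.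
    by case: ifP.
rewrite [RHS]integral_mkcond; apply: eq_integral => t _.
by rewrite !patchE; case: ifP => _; rewrite -EFinM// mulr0.
Qed.

Lemma laplace_first_passage a C k : 0 < a -> k < a / 2 ->
  (forall t, 0 <= t -> - C - k * t <= b t) ->
  (\int[lebesgue_measure]_(t in `]0%R, +oo[) (stopped_value a t * q t)%:E = 1)%E.
Proof.
move=> a0 ka bC.
pose I N := (\int[lebesgue_measure]_(t in `]0%R, N]) (stopped_value a t * q t)%:E)%E.
have mI : measurable_fun (`]0, +oo[ : set R) (fun t => (stopped_value a t * q t)%:E).
  apply/measurable_EFinP; apply: measurable_funM.
    by apply: measurable_funTS; exact: measurable_stopped_value.
  exact: subspace_continuous_measurable_fun.
have I0 t : t \in `]0, +oo[ -> (0 <= (stopped_value a t * q t)%:E)%E.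
  rewrite in_itv/= andbT => t0.
  by rewrite lee_fin mulr_ge0// ?expR_ge0// q0.
(* Outside [hit N], [W N] exceeds [b N - x], hence [- C - k * N - x], and the martingale at [N] is
   at most [expR (c - N * (a * (a / 2 - k)))]. *)
pose c := a * C + a * x.
have key N : 0 < N -> (I N <= 1)%E /\ (1 <= I N + (expR (c - N * (a * (a / 2 - k))))%:E)%E.
  move=> N0.
  rewrite /I -integral_hit_density//; last 2 first.
  - exact: measurable_stopped_value.
  - by move=> t; exact: expR_ge0.
  rewrite stopped_expectation//.
  have E1 := expmart_expectation hW a (ltW N0).
  have mE : measurable_fun setT (fun w => (expmart W a N w)%:E).
    by apply/measurable_EFinP; exact: measurable_expmart.
  have mH := measurable_hit N.
  rewrite -E1; split.
    by apply: ge0_subset_integral => // w _; rewrite lee_fin expR_ge0.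
  rewrite -(setUv (hit N)) ge0_integral_setU//; last 4 first.
  - exact: measurableC.
  - by rewrite setUv.
  - by move=> w _; rewrite lee_fin expR_ge0.
  - exact/disj_setPCl.
  rewrite leeD2l//.
  apply: (@le_trans _ _ (\int[P]_(w in ~` hit N) (expR (c - N * (a * (a / 2 - k))))%:E)%E).
    apply: ge0_le_integral => //.
    - exact: measurableC.
    - by move=> w _; rewrite lee_fin expR_ge0.
    - exact: measurable_funTS.
    - move=> w /= /(not_hit N0) Ww; rewrite lee_fin ler_expR.
      have := bC N (ltW N0) => bN.
      have : a * (- C - k * N - x) <= a * W N w by rewrite ler_wpM2l ?ltW//; lra.
      by rewrite /c => ?; nra.
  rewrite integral_cst//; last exact: measurableC.
  rewrite -[leRHS]mule1 lee_wpmul2l// ?lee_fin ?expR_ge0//.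
  by apply: probability_le1; exact: measurableC.
pose F (n : nat) : set R := `]0, n%:R + 1]%classic.
have FU : \bigcup_n F n = `]0, +oo[%classic.
  apply/seteqP; split => t /=.
    by move=> [n _]; rewrite /F/= !in_itv/= andbT => /andP[].
  rewrite in_itv/= andbT => t0; exists (Num.bound t) => //.
  rewrite /F/= in_itv/= t0/= ltW//.
  by rewrite (lt_trans (archi_boundP (ltW t0)))// ltrDl.
have ndF : nondecreasing_seq F.
  move=> m n mn; apply/subsetPset => t; rewrite /F/= !in_itv/= => /andP[-> /=].
  by move=> /le_trans; apply; rewrite lerD2r ler_nat.
have cvgI : I (n%:R + 1) @[n --> \oo] -->
    (\int[lebesgue_measure]_(t in `]0%R, +oo[) (stopped_value a t * q t)%:E)%E.
  rewrite -FU; apply: ge0_nondecreasing_set_cvg_integral => //.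
  - move=> n; apply: measurable_funS mI => // t; rewrite /F/= !in_itv/= andbT.
    by move=> /andP[].
  - move=> n t; rewrite /F/= in_itv/= => /andP[t0 _].
    by apply: I0; rewrite in_itv/= andbT.
apply/eqP; rewrite eq_le; apply/andP; split.
  apply: (cvge_to_le cvgI); apply: nearW => n.
  by have [] := key (n%:R + 1); rewrite // ltr_wpDl.
apply/lee_addgt0Pr => e e0.
have k0 : 0 < a * (a / 2 - k) by rewrite mulr_gt0// subr_gt0.
(* Chosen so that [c - N * (a * (a / 2 - k)) <= ln e] for [N = n%:R + 1]. *)
pose n := Num.bound `|(c - ln e) / (a * (a / 2 - k))|.
have n1 : 0 < n%:R + 1 :> R by rewrite ltr_wpDl.
have [_ /le_trans] := key _ n1; apply.
apply: leeD.
  apply: ge0_subset_integral => //.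
  by move=> t /=; rewrite !in_itv/= andbT => /andP[].
rewrite lee_fin -[leRHS]lnK ?posrE// ler_expR lerBlDr -lerBlDl.
rewrite -ler_pdivrMr// (le_trans (ler_norm _))// ltW//.
by rewrite (lt_trans (archi_boundP (normr_ge0 _)))// ltrDl.
Qed.

End density_of_first_passage.

End first_passage.

(** * Joint measurability of the passage density *)

Section joint_measurability.
Context (d : measure_display) (T : measurableType d) (R : realType)
  (P : probability T R) (W : R -> {RV P >-> R}).
Hypothesis hW : standard_brownian_motion W.
Variables (b : R -> R).
Hypothesis hb0 : b 0 = 0.
Hypothesis hbc : {within `[0, +oo[, continuous b}.
Variable p : R -> R -> R.
Hypothesis hp : first_passage_density W b p.

(* Nonincreasing in [x] since a farther start delays the passage. *)
Let G s x : R := if 0 < x then fine (P (hit W b x s)) else 1.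

Let mhit x s : 0 < x -> measurable (hit W b x s).
Proof. by move=> x0; exact: measurable_hit. Qed.

(** The value 1 on [x <= 0] dominates every probability, which extends the monotonicity to the whole
    line. *)
Let G_nonincreasing s : nonincreasing_fun (G s).
Proof.
move=> x y xy; rewrite /G; case: ifP => y0; last first.
  have -> : 0 < x = false by apply/negP => x0; move: y0; rewrite (lt_le_trans x0).
  exact: lexx.
have [x0|x0] := ltP 0 x; last first.
  by rewrite -lee_fin fineK ?fin_num_measure ?probability_le1//; exact: mhit.
rewrite fine_le ?fin_num_measure//; try exact: mhit.
apply: le_measure; rewrite ?inE; try exact: mhit.
move=> w; rewrite /hit/=; apply: le_trans.
apply: le_ereal_inf_tmp => _ [t [t0 Wt] <-]; apply: ereal_inf_lbound; exists t => //.
by split => //; apply: le_trans Wt; rewrite lerD2l.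
Qed.

Let measurable_G s : measurable_fun setT (G s).
Proof. exact: nonincreasing_measurable. Qed.

Lemma integral_density_itv x s t : 0 < x -> 0 <= s -> s <= t ->
  (\int[lebesgue_measure]_(u in `]s, t]) (p u x)%:E = (G t x - G s x)%:E)%E.
Proof.
move=> x0 s0 st.
have := @fpd_law _ _ _ _ _ _ _ hp x x0 `]s, t]%classic (measurable_itv _).
rewrite (_ : `]s, t]%classic `&` `]0, +oo[%classic = `]s, t]%classic); last first.
  apply/seteqP; split => u /=; rewrite !in_itv/= andbT; first by case.
  by move=> /andP[su ut]; split; [rewrite su|exact: le_lt_trans su].
move=> <-; rewrite /G x0.
rewrite (_ : _ @^-1` _ = hit W b x t `\` hit W b x s); last first.
  apply/seteqP; split => w.
    move=> [u /=]; rewrite in_itv/= => /andP[su ut] tauu.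
    by rewrite /hit/= -tauu !lee_fin; split => //; apply/negP; rewrite -ltNge.
  move=> [wt ws]; have [r [/andP[r0 rt] _ taur]] := hitP hW hb0 hbc x0 wt.
  exists r => //=; rewrite in_itv/= rt andbT ltNge; apply/negP => rs.
  by apply: ws; rewrite /hit/= taur lee_fin.
rewrite measureD//; try exact: mhit; last by rewrite ltey_eq fin_num_measure//; exact: mhit.
rewrite setIidr; last exact: sub_hit.
by rewrite EFinB !fineK ?fin_num_measure//; exact: mhit.
Qed.

Let mp x : 0 < x -> measurable_fun (`]0, +oo[ : set R) (p ^~ x).
Proof.
move=> x0; apply: subspace_continuous_measurable_fun => //.
exact: fpd_continuous hp _ x0.
Qed.

Let continuous_density x t : 0 < x -> 0 < t -> {for t, continuous (p ^~ x)}.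
Proof.
move=> x0 t0; have := @fpd_continuous _ _ _ _ _ _ _ hp x x0.
rewrite continuous_open_subspace; last exact: interval_open.
by apply; rewrite inE/= in_itv/= t0.
Qed.

(** The fundamental theorem of calculus, with base point [t / 2] because continuity of [p ^~ x] is
    known on the open half-line only. *)
Lemma cvg_difference_quotient_density x t : 0 < x -> 0 < t ->
  n.+1%:R * (G (t + n.+1%:R^-1) x - G t x) @[n --> \oo] --> p t x.
Proof.
move=> x0 t0.
have t2 : 0 < t / 2 by rewrite divr_gt0.
have t2t : t / 2 < t by lra.
pose F y := (\int[lebesgue_measure]_(u in `](t / 2), y]) (p u x))%R.
have FE y : t / 2 <= y -> F y = G y x - G (t / 2) x.
  by move=> ty; rewrite /F /Rintegral integral_density_itv// ltW.
have [] := @continuous_FTC1 R (p ^~ x) (BRight (t / 2)) t (t + 1).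
- by rewrite ltrDl.
- apply/integrableP; split.
    apply/measurable_EFinP; apply: measurable_funS (mp x0) => //.
    by move=> u /=; rewrite !in_itv/= andbT => /andP[/(lt_trans t2)].
  have -> : (\int[lebesgue_measure]_(u in `](t / 2)%R, (t + 1)%R]) `|(EFin \o p ^~ x) u| =
      \int[lebesgue_measure]_(u in `](t / 2)%R, (t + 1)%R]) (p u x)%:E)%E.
    apply: eq_integral => u; rewrite inE/= in_itv/= => /andP[/(lt_trans t2) u0 _] /=.
    by rewrite ger0_norm//; exact: (fpd_ge0 hp).
  by rewrite integral_density_itv ?ltry// ?ltW//; lra.
- exact: t2t.
- exact: continuous_density.
move=> dF F't.
have : (fun h => h^-1 *: ((F \o shift t) (h *: 1) - F t)) @ 0^' --> p t x.
  rewrite -F't derive1E; exact: dF.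
move=> /cvg_dnbhs_at_right /cvg_at_rightP /(_ (fun n => n.+1%:R^-1)) H.
have /H : (forall n, 0 < n.+1%:R^-1 :> R) /\ n.+1%:R^-1 @[n --> \oo] --> (0 : R).
  by split; [move=> n; rewrite invr_gt0|exact: cvg_harmonic].
apply: cvg_trans; apply: near_eq_cvg; apply: nearW => n.
rewrite /= invrK; congr (_ * _); rewrite !FE ?ltW//.
  by rewrite [_ *: 1]mulr1 [_^-1 + t]addrC; ring.
by rewrite [_ *: 1]mulr1 (lt_trans t2t)// ltrDr invr_gt0.
Qed.

Lemma measurable_density_space t : 0 < t -> measurable_fun (`]0, +oo[ : set R) (p t).
Proof.
move=> t0; apply: (@measurable_fun_cvg _ _ _ _
  (fun n x => n.+1%:R * (G (t + n.+1%:R^-1) x - G t x))).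
  move=> n; apply: measurable_funM => //; apply: measurable_funB.
    by apply: measurable_funTS; exact: measurable_G.
  by apply: measurable_funTS; exact: measurable_G.
by move=> x /=; rewrite in_itv/= andbT => x0; exact: cvg_difference_quotient_density.
Qed.

(** Measurability in [x] and continuity in [t] suffice: [t] is replaced by grid points, of which
    there are countably many. *)
Lemma measurable_density : measurable_fun
  (`]0, +oo[ `*` `]0, +oo[ : set (R * R)) (fun z => p z.1 z.2).
Proof.
pose q t : R -> R := p t \_ `]0, +oo[.
have mq t : 0 < t -> measurable_fun setT (q t).
  move=> t0; apply/(measurable_restrictT _ _).1 => //.
  exact: measurable_density_space.
(* The successor makes the grid point positive, where [mq] applies; for [t > 0] it lies within
   [n.+1%:R^-1] of [t]. *)
pose s (n : nat) (t : R) : R := (Num.truncn (t * n.+1%:R)).+1%:R / n.+1%:R.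
apply: (@measurable_fun_cvg _ _ _ _ (fun n z => q (s n z.1) z.2)).
  move=> n; apply: measurable_funTS => _ B mB; rewrite setTI.
  rewrite (_ : _ @^-1` B = \bigcup_k
    ([set t | Num.truncn (t * n.+1%:R) = k] `*` (q (k.+1%:R / n.+1%:R) @^-1` B))); last first.
    apply/seteqP; split => [[t x] /= Bz|[t x] [k _ [/= <-]]//].
    by exists (Num.truncn (t * n.+1%:R)).
  apply: bigcupT_measurable => k; apply: measurableX.
    rewrite (_ : [set t | _] = (fun t : R => (Num.truncn (t * n.+1%:R))%:R : R) @^-1` [set k%:R]).
      rewrite -[X in measurable X]setTI.
      apply: (@nondecreasing_measurable R setT _ measurableT) => // t u tu.
      by rewrite ler_nat; apply: le_truncn; rewrite ler_pM2r.
    apply/seteqP; split => t /=; first by move=> ->.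
    by move/eqP; rewrite eqr_nat => /eqP.
  rewrite -[X in measurable X]setTI.
  by apply: mq => //; rewrite divr_gt0.
move=> [t x] [/=]; rewrite !in_itv/= !andbT => t0 x0.
rewrite (_ : (fun n => _) = (fun n => p (s n t) x)); last first.
  by apply/funext => n; rewrite /q patchE mem_setE in_itv/= x0.
have st : s n t @[n --> \oo] --> t.
  apply/cvgrPdist_le => e e0; near=> n.
  have /andP[lo hi] : (Num.truncn (t * n.+1%:R))%:R <= t * n.+1%:R <
      (Num.truncn (t * n.+1%:R)).+1%:R.
    by apply: truncn_itv; rewrite mulr_ge0// ltW.
  have sge : t <= s n t by rewrite /s ler_pdivlMr// ltW.
  rewrite ler0_norm ?subr_le0// opprB lerBlDr /s ler_pdivrMr// -natr1 mulrDl addrC.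
  rewrite lerD// -ler_pdivrMr// div1r ltW//.
  by near: n; exact: (near_infty_natSinv_lt (PosNum e0)).
exact: (cvg_comp _ _ st (continuous_density x0 t0)).
Unshelve. all: by end_near.
Qed.

End joint_measurability.

(** * The integral equation *)

(** The limit controls [b t + k * t] from some time on; on the compact interval before it,
    continuity provides a minimum. *)
Lemma linear_lower_bound (R : realType) (b : R -> R) (k : R) (l : \bar R) :
  {within `[0, +oo[, continuous b} -> (-oo < l)%E ->
  (b t + k * t)%:E @[t --> +oo] --> l ->
  exists C, forall t, 0 <= t -> - C - k * t <= b t.
Proof.
move=> hbc lNy bl.
have [M Ml] : exists M : R, (M%:E < l)%E.
  case: l lNy {bl} => [r| |]// _; last by exists 0; exact: ltry.
  by exists (r - 1); rewrite lte_fin ltrBlDr ltrDl.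
have := bl _ (open_ereal_gt' Ml) => -[T0 [_ HT]].
pose T1 := Num.max T0 0 + 1.
have T1_0 : 0 <= T1 by rewrite /T1 addr_ge0// le_max lexx orbT.
have cf : {within `[0, T1], continuous (fun t => b t + k * t)}.
  apply: within_continuousD.
    by apply: continuous_subspaceW hbc => t /=; rewrite !in_itv/= => /andP[->].
  by apply: continuous_subspaceT => t; apply: cvgM; [exact: cvg_cst|exact: cvg_id].
have [c _ cmin] := EVT_min T1_0 cf.
exists (Num.max (- M) (- (b c + k * c))) => t t0.
have [tT|Tt] := leP t T1.
  have := cmin t; rewrite in_itv/= t0 tT => /(_ isT) H.
  have : - (b c + k * c) <= Num.max (- M) (- (b c + k * c)) by rewrite le_max lexx orbT.
  by lra.
have /HT : T0 < t.
  apply: le_lt_trans Tt; rewrite /T1.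
  have : T0 <= Num.max T0 0 by rewrite le_max lexx.
  by lra.
rewrite /= lte_fin => H.
have : - M <= Num.max (- M) (- (b c + k * c)) by rewrite le_max lexx.
by lra.
Qed.

(** * Laplace transforms of functions of class G *)

Section laplace_class_G.
Context {R : realType}.
Local Notation mu := (@lebesgue_measure R).

Lemma integrable_expRN (a : R) : 0 < a ->
  mu.-integrable `]0, +oo[ (fun x => (expR (- (a * x)))%:E).
Proof.
move=> a0.
have := integrableZl measurableT a^-1 (integrable_exponential_pdf a0).
move=> ie.
have : mu.-integrable `]0, +oo[ (fun x => a^-1%:E * (EFin \o exponential_pdf a) x)%E.
  exact: integrableS ie.
apply: eq_integrable => // x; rewrite inE/= in_itv/= andbT => x0.
by rewrite /= exponential_pdfE ?ltW// -EFinM mulrA mulVf ?gt_eqF// mul1r mulNr.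
Qed.

Lemma integrable_laplace (a : R) (h : R -> R) : 0 < a -> class_G h ->
  mu.-integrable `]0, +oo[ (fun x => (expR (- (a * x)) * h x)%:E).
Proof.
move=> a0 [mh hh].
have mI : measurable_fun (`]0, +oo[ : set (measurableTypeR R))
    (fun x => (expR (- (a * x)) * h x)%:E).
  apply/measurable_EFinP; apply: measurable_funM => //; apply: measurable_funTS.
  by apply: measurableT_comp => //; apply: measurableT_comp => //; exact: measurable_funM.
case: hh => [ih|[K hK]].
  apply: (le_integrable _ mI _ ih) => // x /=; rewrite in_itv/= andbT => x0.
  rewrite lee_fin normrM ler_piMl// ger0_norm ?expR_ge0// -expR0 ler_expR.
  by rewrite oppr_le0 mulr_ge0// ltW.
apply/integrableP; split => //.
have : mu.-integrable `]0, +oo[ (fun x => K%:E * (expR (- (a * x)))%:E)%E.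
  by apply: integrableZl => //; exact: integrable_expRN.
move=> /integrableP[mE E_lt].
apply: le_lt_trans E_lt; apply: ae_ge0_le_integral => //.
- exact: measurableT_comp.
- exact: measurableT_comp.
- move: hK; apply: filterS; first exact: (ae_filter_ringOfSetsType mu).
  move=> x hx; rewrite /= in_itv/= andbT => /hx {}hx.
  rewrite lee_fin !normrM mulrC ler_wpM2r// (le_trans (ltW hx))//.
  exact: ler_norm.
Qed.

(** [h - g] may fail to be integrable when a bound is all that is known, so one factor [expR (- x)]
    is absorbed into the tested function; its moment of order [m] is then a difference of transforms
    at [m.+1]. *)
Lemma laplace_transform_inj (g h : R -> R) : class_G g -> class_G h ->
  (forall a, 0 < a -> laplace_transform g a = laplace_transform h a) ->
  {ae mu, forall x : R, 0 < x -> h x = g x}.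
Proof.
move=> Gg Gh gh.
pose k (m : nat) (x : R) := expR (- (m.+1%:R * x)) * (h x - g x).
have m0 (m : nat) : 0 < m.+1%:R :> R by [].
have kE m : EFin \o k m = ((fun x => (expR (- (m.+1%:R * x)) * h x)%:E) \-
    (fun x => (expR (- (m.+1%:R * x)) * g x)%:E))%E :> (R -> \bar R).
  by apply/funext => x /=; rewrite -EFinB -mulrBr.
have ik m : mu.-integrable `]0, +oo[ (EFin \o k m).
  by rewrite kE; apply: integrableB => //; exact: integrable_laplace.
have k0 m : (\int[mu]_(x in `]0%R, +oo[) (k m x)%:E = 0)%E.
  transitivity (\int[mu]_(x in `]0%R, +oo[) (EFin \o k m) x)%E => //.
  rewrite kE integralB//; [|exact: integrable_laplace|exact: integrable_laplace].
  have := gh _ (m0 m); rewrite /laplace_transform => ->; rewrite subee//.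
  exact: integrable_fin_num (integrable_laplace (m0 m) Gh).
pose K := k 0%N \_ `]0, +oo[.
have KE m x : expR (- (m%:R * x)) * K x = (k m \_ `]0, +oo[) x.
  rewrite /K !patchE; case: ifPn => _; last by rewrite mulr0.
  by rewrite /k mulrA -expRD -natr1; congr (expR _ * _); ring.
have := @laplace_moments_inj R K _ _ _.
case.
- rewrite -restrict_EFin; apply/(integrable_mkcond _ _).1 => //.
- by move=> x x0; rewrite /K patchE mem_setE in_itv/= andbT ltNge x0.
- move=> m; under eq_integral do rewrite KE.
  by rewrite -(k0 m) [RHS]integral_mkcond; apply: eq_integral => x _; rewrite restrict_EFin.
move=> N [mN N0 KN]; exists N; split => // x /= H; apply: KN => /= Kx; apply: H => x0.
move: Kx; rewrite /K patchE mem_setE in_itv/= x0/= /k => /eqP.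
by rewrite mulf_eq0 gt_eqF ?expR_gt0//= subr_eq0 => /eqP.
Qed.

End laplace_class_G.

(** * Exchange of integrals and the transform of a solution *)

Section laplace_of_solution.
Context (d : measure_display) (T : measurableType d) (R : realType)
  (P : probability T R) (W : R -> {RV P >-> R}).
Hypothesis hW : standard_brownian_motion W.
Variables (b : R -> R).
Hypothesis hb0 : b 0 = 0.
Hypothesis hbc : {within `[0, +oo[, continuous b}.
Hypothesis hblim : forall a : R, 0 < a -> exists l : \bar R,
  (-oo < l)%E /\ (b t + a * t)%:E @[t --> +oo] --> l.
Variable p : R -> R -> R.
Hypothesis hp : first_passage_density W b p.
Local Notation mu := (@lebesgue_measure R).
Local Notation D := (`]0, +oo[%classic : set R).
Local Notation MR := (measurableTypeR R).

(** Starting point 0 removes the factor [expR (a * x)], so that the weight does not depend on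
    [x]. *)
Let E (a t : R) : R := stopped_value b 0 a t.

Let E_ge0 a t : 0 <= E a t. Proof. exact: expR_ge0. Qed.

Let mE a : measurable_fun setT (E a).
Proof. exact: measurable_stopped_value. Qed.

Let EE a t : 0 <= t -> E a t = expR (- (a * b t) - t * a ^+ 2 / 2).
Proof.
rewrite le_eqVlt /E /stopped_value patchE mem_setE in_itv/= subr0.
by case/predU1P => [<-|->]; rewrite ?ltxx ?hb0.
Qed.

Lemma integral_kernel a x : 0 < a -> 0 < x ->
  (\int[mu]_(t in D) (E a t * p t x)%:E = (expR (- (a * x)))%:E)%E.
Proof.
move=> a0 x0.
(* Any slope in []0, a / 2[] would do: positive for the growth condition, below [a / 2] for the
   decay. *)
have a4 : 0 < a / 4 by rewrite divr_gt0.
have [l [lNy bl]] := hblim a4.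
have [C HC] := linear_lower_bound hbc lNy bl.
have a42 : a / 4 < a / 2 by lra.
have L1 := laplace_first_passage hW hb0 hbc x0 (fun t => @fpd_ge0 _ _ _ _ _ _ _ hp x t x0)
  (@fpd_continuous _ _ _ _ _ _ _ hp x x0) (@fpd_law _ _ _ _ _ _ _ hp x x0) a0 a42 HC.
transitivity (\int[mu]_(t in D) ((expR (- (a * x)))%:E * (stopped_value b x a t * p t x)%:E))%E.
  apply: eq_integral => t _; rewrite -EFinM mulrA; congr (_ * _)%:E.
  by rewrite /E /stopped_value -expRD; congr expR; ring.
rewrite ge0_integralZl ?lee_fin ?expR_ge0//; last 2 first.
- apply/measurable_EFinP; apply: measurable_funM.
    by apply: measurable_funTS; exact: measurable_stopped_value.
  apply: subspace_continuous_measurable_fun => //.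
  exact: (@fpd_continuous _ _ _ _ _ _ _ hp x x0).
- move=> t /=; rewrite in_itv/= andbT => t0.
  by rewrite lee_fin mulr_ge0 ?expR_ge0//; exact: (fpd_ge0 hp).
by rewrite L1 mule1.
Qed.

Variables (f h : R -> R).
Hypothesis mf : measurable_fun (`[0, +oo[ : set R) f.
Hypothesis mh : measurable_fun D h.
Hypothesis hs : solves_integral_equation p f h.
Variable a : R.
Hypothesis a0 : 0 < a.
Hypothesis ih : mu.-integrable D (fun x => (expR (- (a * x)) * h x)%:E).

(** Extension by 0 lets Fubini be applied on the full product space. *)
Let pp : R * R -> R := (fun z => p z.1 z.2) \_ (D `*` D).
Let hh : R -> R := h \_ D.
Let H (z : MR * MR) : \bar R := (E a z.1 * pp z * hh z.2)%:E.

Let inD (y : R) : (y \in D) = (0 < y).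
Proof. by rewrite mem_setE in_itv/= andbT. Qed.

Let mpp : measurable_fun setT pp.
Proof.
apply/(measurable_restrictT _ _).1; first exact: measurableX.
exact: (measurable_density hW hb0 hbc hp).
Qed.

Let mH : measurable_fun setT H.
Proof.
apply/measurable_EFinP; apply: measurable_funM.
  apply: measurable_funM; last exact: mpp.
  exact: (measurableT_comp (mE a) (@measurable_fst _ _ _ _)).
have mhh : measurable_fun (setT : set MR) hh by exact/(measurable_restrictT _ _).1.
exact: (measurableT_comp mhh (@measurable_snd _ _ _ _)).
Qed.

Let ppE t x : 0 < x -> pp (t, x) = (p ^~ x \_ D) t.
Proof.
by move=> x0; rewrite /pp !patchE in_setX /= !inD x0 andbT.
Qed.

Let pp0 t x : x <= 0 -> pp (t, x) = 0.
Proof.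
by move=> x0; rewrite /pp patchE in_setX /= !inD [0 < x]ltNge x0 andbF.
Qed.

Let pp_ge0 z : 0 <= pp z.
Proof.
case: z => t x; have [x0|x0] := leP x 0; first by rewrite pp0.
rewrite ppE// patchE; case: ifPn => //.
by rewrite mem_setE in_itv/= andbT => t0; exact: (fpd_ge0 hp).
Qed.

Let integral_Epp x : 0 < x -> (\int[mu]_t (E a t * pp (t, x))%:E = (expR (- (a * x)))%:E)%E.
Proof.
move=> x0; rewrite -integral_kernel// [RHS]integral_mkcond; apply: eq_integral => t _.
by rewrite ppE// !patchE; case: ifP => // _; rewrite mulr0.
Qed.

Let mEpp x : measurable_fun (setT : set MR) (fun t => (E a t * pp (t, x))%:E).
Proof.
apply/measurable_EFinP; apply: measurable_funM; first exact: mE.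
exact: (measurableT_comp mpp (@measurable_pair2 _ _ MR MR x)).
Qed.

Let integral_abs_H x : (\int[mu]_t `|H (t, x)| =
  ((fun x => `|(expR (- (a * x)) * h x)%:E|) \_ D) x)%E.
Proof.
rewrite patchE mem_setE in_itv/= andbT.
have [x0|x0] := ltP 0 x; last first.
  by rewrite integral0_eq// => t _; rewrite /H pp0// mulr0 mul0r normr0.
transitivity (\int[mu]_t ((`|h x|)%:E * (E a t * pp (t, x))%:E))%E.
  apply: eq_integral => t _; rewrite /H /hh /= patchE mem_setE in_itv/= x0.
  rewrite -EFinM; congr (_%:E); rewrite normrM mulrC; congr (_ * _).
  by rewrite ger0_norm// mulr_ge0.
rewrite ge0_integralZl ?lee_fin//; last by move=> t _; rewrite lee_fin mulr_ge0.
by rewrite integral_Epp// -EFinM /= normrM mulrC ger0_norm// expR_ge0.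
Qed.

(** The kernel is nonnegative with integral [expR (- (a * x))] in [t], so integrating the absolute
    value in [t] first leaves exactly what [ih] controls. *)
Let iH : (mu \x mu)%E.-integrable setT H.
Proof.
apply/(integrable21ltyP _ _ mH).
under eq_integral do rewrite integral_abs_H.
rewrite -integral_mkcond.
by have /integrableP[] := ih.
Qed.

Let integral_H x : (\int[mu]_t H (t, x) =
  ((fun x => (expR (- (a * x)) * h x)%:E) \_ D) x)%E.
Proof.
rewrite patchE mem_setE in_itv/= andbT.
have [x0|x0] := ltP 0 x; last first.
  by rewrite integral0_eq// => t _; rewrite /H pp0// mulr0 mul0r.
transitivity (\int[mu]_t ((h x)%:E * (E a t * pp (t, x))%:E))%E.
  apply: eq_integral => t _; rewrite /H /hh /= patchE mem_setE in_itv/= x0.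
  by rewrite -EFinM mulrC.
rewrite integralZl//; last first.
  apply/integrableP; split; first exact: mEpp.
  under eq_integral do rewrite gee0_abs ?lee_fin ?mulr_ge0//.
  by rewrite integral_Epp// ltry.
by rewrite integral_Epp// -EFinM mulrC.
Qed.

Lemma laplace_transform_solution :
  laplace_transform h a =
  (\int[mu]_(t in `[0%R, +oo[) (expR (- (a * b t) - t * a ^+ 2 / 2) * f t)%:E)%E.
Proof.
transitivity (\int[mu]_x \int[mu]_t H (t, x))%E.
  under [RHS]eq_integral do rewrite integral_H.
  by rewrite -integral_mkcond.
rewrite -(Fubini iH).
rewrite [RHS]integral_mkcond.
have mEf : measurable_fun (setT : set MR)
    ((fun t => (expR (- (a * b t) - t * a ^+ 2 / 2) * f t)%:E) \_ `[0, +oo[).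
  apply/(measurable_restrictT _ _).1 => //.
  apply/measurable_EFinP; apply: measurable_funM => //.
  apply: (eq_measurable_fun (E a)); last exact: measurable_funTS.
  by move=> t; rewrite inE/= in_itv/= andbT => t0; rewrite EE.
apply: ae_eq_integral => //; first exact: (measurable_fubini_F iH).
(* [t = 0] is discarded: the extended kernel vanishes there, whereas the equation may hold at 0 with
   [f 0] nonzero. *)
have ae_ne0 : {ae mu, forall t : R, t != 0}.
  exists [set 0]; split => //; first exact: lebesgue_measure_set1.
  by move=> t /= /negP; rewrite negbK => /eqP.
have := ae_integrable1 iH.
move: hs ae_ne0; rewrite /solves_integral_equation.
apply: filterS3; first exact: (ae_filter_ringOfSetsType mu).
move=> t hst tne0 iHt _; rewrite patchE mem_setE in_itv/= andbT.
have [t_lt0|t_gt0|t_eq0] := ltgtP t 0; last by rewrite t_eq0 eqxx in tne0.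
  rewrite integral0_eq// => x _; rewrite /H /pp patchE in_setX /= !inD.
  by rewrite [0 < t]ltNge ltW//= mulr0 mul0r.
have E0 : E a t != 0 by rewrite gt_eqF// expR_gt0.
(* The equation carries no weight, but integrability in [x] is known for [H (t, x)]; hence [H] is
   divided by the positive [E a t] and the constant is then pulled out. *)
have : (\int[mu]_x ((E a t)^-1%:E * H (t, x)) = (f t)%:E)%E.
  rewrite -(hst (ltW t_gt0)) [RHS]integral_mkcond; apply: eq_integral => x _.
  rewrite /H -EFinM /hh !patchE; case: ifPn => xD; last by rewrite mulr0 mulr0.
  rewrite /pp patchE in_setX /= xD inD t_gt0/=.
  by rewrite -mulrA mulKf.
rewrite integralZl// -EE ?ltW// EFinM => <-.
by rewrite muleA -EFinM mulfV// mul1e.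
Qed.

End laplace_of_solution.

Theorem proposition2p2 (d : measure_display) (T : measurableType d)
    (R : realType) (P : probability T R) (W : R -> {RV P >-> R})
    (hW : standard_brownian_motion W)
    (b : R -> R) (hb0 : b 0 = 0) (hbd : continuously_differentiable b)
    (p : R -> R -> R) (hp : first_passage_density W b p)
    (f : R -> R) (hf : probability_density f)
    (hbc : {within `[0, +oo[, continuous b})
    (hblim : forall a : R, 0 < a -> exists l : \bar R,
       (-oo < l)%E /\ (b t + a * t)%:E @[t --> +oo] --> l)
    (g : R -> R) (hgG : class_G g) (hg : solves_integral_equation p f g) :
  (forall h : R -> R, class_G h -> solves_integral_equation p f h ->
     {ae lebesgue_measure, forall x : R, 0 < x -> h x = g x}) /\
  (forall a : R, 0 < a ->
     laplace_transform g a =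
     (\int[lebesgue_measure]_(t in `[0%R, +oo[)
        (expR (- (a * b t) - t * a ^+ 2 / 2) * f t)%:E)%E).
Proof.
have sol h : class_G h -> solves_integral_equation p f h -> forall a, 0 < a ->
    laplace_transform h a = (\int[lebesgue_measure]_(t in `[0%R, +oo[)
      (expR (- (a * b t) - t * a ^+ 2 / 2) * f t)%:E)%E.
  move=> Gh hs a a0; have [mf _ _] := hf; have [mh _] := Gh.
  exact: (laplace_transform_solution hW hb0 hbc hblim hp mf mh hs a0
    (integrable_laplace a0 Gh)).
split; last exact: sol.
move=> h Gh hs; apply: laplace_transform_inj => // a a0.
by rewrite !sol.
Qed.
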